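(* Let $X$ be a compact geodesic space. Then $X$ has a simply connected cover if and only if $Cr(X)$ is finite and $\pi_{cl}(X)=1$. Moreover, for these conditions to hold it is necessary that $\pi_1(X)$, $\bar{\pi}_1(X)$, and $\Delta(X)$ be mutually isomorphic.
   Context: A geodesic space is a metric space in which any two points are joined by a curve whose length equals the distance between them. A cover is a connected covering space in the traditional sense. Let $X$ be a geodesic space with base point $*$ (immaterial up to isomorphism). For $\varepsilon>0$, an $\varepsilon$-chain is a finite sequence $\{x_0,\dots,x_n\}$ in $X$ with $d(x_{i-1},x_i)<\varepsilon$ for all $i$. A basic move adds or removes one point, keeping the endpoints fixed and keeping the result an $\varepsilon$-chain; two $\varepsilon$-chains are $\varepsilon$-homotopic if connected by finitely many basic moves; $[\alpha]_\varepsilon$ is the resulting class. $\pi_\varepsilon(X)$ is the group, under concatenation, of classes of $\varepsilon$-loops ($\varepsilon$-chains that start and end at $*$); an $\varepsilon$-loop is $\varepsilon$-null if its class is that of $\{*\}$. For $\delta<\varepsilon$, $\Phi_{\varepsilon\delta}:\pi_\delta(X)\to\pi_\varepsilon(X)$ is $[\alpha]_\delta\mapsto[\alpha]_\varepsilon$. A strong $\varepsilon$-chain along a path $\gamma:[a,b]\to X$ is an $\varepsilon$-chain $\{\gamma(t_0),\dots,\gamma(t_n)\}$ for a partition $a=t_0<\dots<t_n=b$ with $\gamma([t_{i-1},t_i])\subset B_\varepsilon(\gamma(t_{i-1}))\cap B_\varepsilon(\gamma(t_i))$ for each $i$. The well-defined surjective homomorphism $h_\varepsilon:\pi_1(X)\to\pi_\varepsilon(X)$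 sends $[\gamma]$ to the class of any strong $\varepsilon$-chain along $\gamma$. Put $K_\varepsilon=\ker h_\varepsilon$, $\pi_{cl}(X)=\bigcap_{\varepsilon>0}K_\varepsilon$, $\bar{\pi}_1(X)=\pi_1(X)/\pi_{cl}(X)$, and $\Delta(X)=\varprojlim_\varepsilon\pi_\varepsilon(X)$ with bonding maps $\Phi_{\varepsilon\delta}$. ''$\pi_{cl}(X)=1$'' means it is the trivial subgroup. For compact geodesic $X$, $Cr(X)$ is the set of $\varepsilon>0$ (critical values) for which there is an $\varepsilon$-loop at $*$ that is not $\varepsilon$-null but is $\delta$-null for all $\delta>\varepsilon$. *)

(* Defs.v *)
From HB Require Import structures.
From Stdlib Require Import Relation_Operators.
From mathcomp Require Import all_boot all_order all_algebra generic_quotient.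
From mathcomp Require Import ring lra.
From mathcomp Require Import interval_inference mathcomp_extra boolp.
From mathcomp Require Import classical_sets functions cardinality reals ereal.
From mathcomp Require Import topology normedtype numfun.

Set Implicit Arguments.
Unset Strict Implicit.
Unset Printing Implicit Defensive.

Import Order.TTheory GRing.Theory Num.Theory.
Import numFieldNormedType.Exports.

Local Open Scope classical_set_scope.
Local Open Scope ring_scope.
Local Open Scope quotient_scope.

Definition isomorphic_groups (G H : groupType) : Prop :=
  exists2 f : G -> H, bijective f & forall x y, f (x * y)%g = (f x * f y)%g.

Record normal_subgroup (G : groupType) (N : set G) : Prop := NormalSubgroup {
  normal_subgroup1 : N 1%g;
  normal_subgroupM : forall x y, N x -> N y -> N (x * y)%g;
  normal_subgroupV : forall x, N x -> N x^-1%g;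
  normal_subgroupJ : forall x y, N x -> N (x ^ y)%g }.

Section QuotientGroup.
Variables (G : groupType) (N : set G) (nN : normal_subgroup N).

Definition coset_rel (x y : G) : bool := `[< N (x^-1 * y)%g >].

Local Lemma coset_refl : reflexive coset_rel.
Proof. by move=> x; apply/asboolP; rewrite mulVg; apply: normal_subgroup1. Qed.

Local Lemma coset_sym : symmetric coset_rel.
Proof.
suff h x y : coset_rel x y -> coset_rel y x by move=> x y; apply/idP/idP; apply: h.
move=> /asboolP /(normal_subgroupV nN); rewrite invgM invgK => h.
by apply/asboolP.
Qed.

Local Lemma coset_trans : transitive coset_rel.
Proof.
move=> y x z /asboolP xy /asboolP yz; apply/asboolP.
have := normal_subgroupM nN xy yz.
by rewrite mulgA -[(_ * y * _)%g]mulgA mulgV mulg1.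
Qed.

Definition coset_equiv := EquivRel coset_rel coset_refl coset_sym coset_trans.

Definition quotient_group := {eq_quot coset_equiv}.
HB.instance Definition _ := Choice.on quotient_group.
HB.instance Definition _ := Quotient.on quotient_group.

Definition quotient_pi (x : G) : quotient_group := \pi_quotient_group x.
Definition quotient_mul (a b : quotient_group) := quotient_pi (repr a * repr b)%g.
Definition quotient_inv (a : quotient_group) := quotient_pi (repr a)^-1%g.

Local Lemma qpiP x y : quotient_pi x = quotient_pi y <-> N (x^-1 * y)%g.
Proof.
split=> [/eqmodP h|h]; first exact/asboolP.
by apply/eqmodP/asboolP.
Qed.

Local Lemma qreprP x : N ((repr (quotient_pi x))^-1 * x)%g.
Proof. by apply/qpiP; rewrite /quotient_pi reprK. Qed.

Local Lemma qmulE x y : quotient_mul (quotient_pi x) (quotient_pi y) = quotient_pi (x * y)%g.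
Proof.
apply/qpiP; set a := repr _; set b := repr _.
have -> : ((a * b)^-1 * (x * y) = (a^-1 * x) ^ b * (b^-1 * y))%g.
  by rewrite /conjg invgM !mulgA mulgK.
apply: (normal_subgroupM nN); last exact: qreprP.
exact/(normal_subgroupJ nN)/qreprP.
Qed.

Local Lemma qinvE x : quotient_inv (quotient_pi x) = quotient_pi x^-1%g.
Proof.
apply/qpiP; rewrite invgK; set a := repr _.
have -> : (a * x^-1 = ((a^-1 * x)^-1) ^ a^-1)%g.
  by rewrite /conjg invgK invgM invgK !mulgA mulgK.
exact/(normal_subgroupJ nN)/(normal_subgroupV nN)/qreprP.
Qed.

Local Lemma qsurj (a : quotient_group) : exists x, a = quotient_pi x.
Proof. by exists (repr a); rewrite /quotient_pi reprK. Qed.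

Local Lemma qmulA : associative quotient_mul.
Proof.
move=> a b c; have [x ->] := qsurj a; have [y ->] := qsurj b; have [z ->] := qsurj c.
by rewrite !qmulE mulgA.
Qed.
Local Lemma qmul1 : left_id (quotient_pi 1%g) quotient_mul.
Proof. by move=> a; have [x ->] := qsurj a; rewrite qmulE mul1g. Qed.
Local Lemma q1mul : right_id (quotient_pi 1%g) quotient_mul.
Proof. by move=> a; have [x ->] := qsurj a; rewrite qmulE mulg1. Qed.
Local Lemma qmulV : left_inverse (quotient_pi 1%g) quotient_inv quotient_mul.
Proof. by move=> a; have [x ->] := qsurj a; rewrite qinvE qmulE mulVg. Qed.
Local Lemma qVmul : right_inverse (quotient_pi 1%g) quotient_inv quotient_mul.
Proof. by move=> a; have [x ->] := qsurj a; rewrite qinvE qmulE mulgV. Qed.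

HB.instance Definition _ :=
  isGroup.Build quotient_group qmulA qmul1 q1mul qmulV qVmul.

Lemma quotient_piM (x y : G) :
  quotient_pi (x * y)%g = (quotient_pi x * quotient_pi y)%g.
Proof. exact/esym/qmulE. Qed.

Lemma quotient_piP (x y : G) :
  quotient_pi x = quotient_pi y <-> N (x^-1 * y)%g.
Proof. exact: qpiP. Qed.

End QuotientGroup.

Section Continuity.

Lemma within_comp (S T U : topologicalType) (A : set S) (B : set T)
    (g : S -> T) (f : T -> U) :
  (forall x, A x -> B (g x)) -> continuous g -> {within B, continuous f} ->
  {within A, continuous (f \o g)}.
Proof.
move=> AB cg /subspace_continuousP cf; apply/subspace_continuousP => x Ax V nV.
have := cg x _ (cf _ (AB _ Ax) _ nV); rewrite /= !nbhs_simpl /within /=.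
by apply: filterS => y BV Ay; apply/BV/AB.
Qed.

Lemma within_glue (S T : topologicalType) (A B : set S) (f g h : S -> T) :
  closed A -> closed B ->
  {within A, continuous f} -> {within B, continuous g} ->
  (forall x, A x -> h x = f x) -> (forall x, B x -> h x = g x) ->
  {within A `|` B, continuous h}.
Proof.
move=> cA cB cf cg hf hg; apply: withinU_continuous => //.
  by apply: subspace_eq_continuous cf => x /set_mem Ax; exact/esym/hf.
by apply: subspace_eq_continuous cg => x /set_mem Bx; exact/esym/hg.
Qed.

Lemma within_eq (S T : topologicalType) (A : set S) (f g : S -> T) :
  (forall x, A x -> f x = g x) ->
  {within A, continuous f} -> {within A, continuous g}.
Proof. by move=> fg; apply: subspace_eq_continuous => x /set_mem /fg. Qed.

Lemma continuous_pair (S T U : topologicalType) (p : S -> T) (q : S -> U) :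
  continuous p -> continuous q -> continuous (fun u => (p u, q u)).
Proof.
move=> cp cq u.
exact: (@cvg_pair _ _ _ (nbhs u) (nbhs (p u)) (nbhs (q u)) _ _ _ p q (cp u) (cq u)).
Qed.

Lemma continuous_proj1 (S T : topologicalType) : continuous (@fst S T).
Proof. by move=> u; exact: cvg_fst. Qed.

Lemma continuous_proj2 (S T : topologicalType) : continuous (@snd S T).
Proof. by move=> u; exact: cvg_snd. Qed.

Lemma closed_prod (S T : topologicalType) (A : set S) (B : set T) :
  closed A -> closed B -> closed (A `*` B).
Proof.
move=> cA cB; have -> : A `*` B = (fst @^-1` A) `&` (snd @^-1` B) by [].
by apply: closedI; apply: preimage_closed => // u _;
  [exact: continuous_proj1|exact: continuous_proj2].
Qed.

Variable R : realType.

Lemma continuous_affine_fst (a b : R) (S : topologicalType) :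
  continuous (fun u : R * S => a * u.1 + b).
Proof.
move=> u; apply: cvgD; last exact: cvg_cst.
by apply: cvgM; [exact: cvg_cst|exact: cvg_fst].
Qed.

Lemma continuous_affine_snd (a b : R) (S : topologicalType) :
  continuous (fun u : S * R => a * u.2 + b).
Proof.
move=> u; apply: cvgD; last exact: cvg_cst.
by apply: cvgM; [exact: cvg_cst|exact: cvg_snd].
Qed.

Lemma continuous_maxf (f g : R -> R) : continuous f -> continuous g ->
  continuous (fun t => Num.max (f t) (g t)).
Proof. by move=> cf cg x; apply: (@continuous_max R R f g x (cf x) (cg x)). Qed.

Lemma continuous_minf (f g : R -> R) : continuous f -> continuous g ->
  continuous (fun t => Num.min (f t) (g t)).
Proof. by move=> cf cg x; apply: (@continuous_min R R f g x (cf x) (cg x)). Qed.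

Lemma continuous_affine (a b : R) : continuous (fun t : R => a * t + b).
Proof.
by move=> x; apply: cvgD; [apply: cvgM; [exact: cvg_cst|exact: cvg_id]|exact: cvg_cst].
Qed.

End Continuity.

Section Paths.
Variables (R : realType) (T : topologicalType).
Implicit Types (f g h : R -> T) (x y z : T).

(* A path is a function on [R] of which only the restriction to [[0, 1]]
   matters. *)
Definition is_path f x y : Prop :=
  [/\ {within `[0, 1], continuous f}, f 0 = x & f 1 = y].

Definition path_homotopic f g : Prop :=
  exists H : R * R -> T,
    [/\ {within `[0, 1] `*` `[0, 1], continuous H},
        forall t, t \in `[0, 1] -> H (0, t) = f t /\ H (1, t) = g t
      & forall s, s \in `[0, 1] -> H (s, 0) = f 0 /\ H (s, 1) = f 1].

Definition path_cat f g (t : R) : T :=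
  if t <= 2^-1 then f (2 * t) else g (2 * t - 1).

Definition path_rev f (t : R) : T := f (1 - t).

Lemma in01 (t : R) : (t \in `[0, 1]) = (0 <= t <= 1).
Proof. by rewrite in_itv. Qed.

Lemma within_comp1 (S : topologicalType) (A : set S) (p : S -> R) f :
  (forall u, A u -> `[0, 1]%classic (p u)) -> continuous p ->
  {within `[0, 1], continuous f} -> {within A, continuous (f \o p)}.
Proof. exact: within_comp. Qed.

Lemma within_comp2 (S : topologicalType) (A : set S) (p : S -> R * R)
    (H : R * R -> T) :
  (forall u, A u -> (`[0, 1] `*` `[0, 1])%classic (p u)) -> continuous p ->
  {within `[0, 1] `*` `[0, 1], continuous H} -> {within A, continuous (H \o p)}.
Proof. exact: within_comp. Qed.

Lemma path_catP f g x y z :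
  is_path f x y -> is_path g y z -> is_path (path_cat f g) x z.
Proof.
move=> [cf f0 f1] [cg g0 g1]; split; last 2 first.
- by rewrite /path_cat invr_ge0 ler0n mulr0.
- rewrite /path_cat; case: ifP => h; first by exfalso; move: h; lra.
  by rewrite mulr1 -[X in X - 1]/(1 + 1) addrK.
have cover : `[0 : R, 1]%classic = `[0, 2^-1] `|` `[2^-1, 1].
  apply/seteqP; split=> t /=; rewrite !in_itv /=.
    move=> /andP[t0 t1]; case: (leP t 2^-1) => h; [left|right]; first by rewrite t0.
    by rewrite ltW.
  by case=> /andP[h1 h2]; lra.
rewrite cover; apply: (@within_glue _ _ _ _ (f \o (fun t => 2 * t + 0)) (g \o (fun t => 2 * t + -1))).
- exact: itv_closed.
- exact: itv_closed.
- apply: within_comp1 => //; last exact: continuous_affine.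
  by move=> t /=; rewrite !in_itv /= => /andP[]; lra.
- apply: within_comp1 => //; last exact: continuous_affine.
  by move=> t /=; rewrite !in_itv /= => /andP[]; lra.
- by move=> t /=; rewrite in_itv /= /path_cat addr0 => /andP[_ ->].
- move=> t /=; rewrite in_itv /= /path_cat => /andP[h1 h2].
  case: ifP => h3 //; have -> : t = 2^-1 by lra.
  by rewrite divff ?pnatr_eq0 // subrr g0 f1.
Qed.

Lemma path_revP f x y : is_path f x y -> is_path (path_rev f) y x.
Proof.
move=> [cf f0 f1]; split; rewrite /path_rev ?subr0 ?subrr //.
apply: (@within_eq _ _ _ (f \o (fun t => -1 * t + 1))).
  by move=> t _ /=; congr f; ring.
apply: within_comp1 => //; last exact: continuous_affine.
by move=> t /=; rewrite !in_itv /= => /andP[]; lra.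
Qed.

Lemma is_path_cst x : is_path (fun=> x) x x.
Proof. by split=> //; apply: continuous_subspaceT => t; apply: cvg_cst. Qed.

Lemma path_reparam f (p q : R -> R) :
  {within `[0, 1], continuous f} -> continuous p -> continuous q ->
  (forall t, 0 <= t <= 1 -> 0 <= p t <= 1) ->
  (forall t, 0 <= t <= 1 -> 0 <= q t <= 1) ->
  p 0 = q 0 -> p 1 = q 1 -> path_homotopic (f \o p) (f \o q).
Proof.
move=> cf cp cq ip iq pq0 pq1.
exists (f \o (fun u : R * R => (1 - u.1) * p u.2 + u.1 * q u.2)); split.
- apply: within_comp1 => //.
    move=> [s t] /= []; rewrite !in_itv /= => s01 /[dup] /ip /andP[? ?] /iq /andP[? ?].
    by nra.
  move=> u; apply: cvgD; apply: cvgM.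
  + by apply: cvgB; [exact: cvg_cst|exact: cvg_fst].
  + exact: (@cvg_comp _ _ _ snd p _ _ _ cvg_snd (cp u.2)).
  + exact: cvg_fst.
  + exact: (@cvg_comp _ _ _ snd q _ _ _ cvg_snd (cq u.2)).
- by move=> t _ /=; split; congr f; ring.
- by move=> s _ /=; rewrite -pq0 -pq1; split; congr f; ring.
Qed.

Lemma path_homotopic_eq f g : {within `[0, 1], continuous f} ->
  (forall t, 0 <= t <= 1 -> f t = g t) -> path_homotopic f g.
Proof.
move=> cf fg; exists (f \o snd); split.
- apply: within_comp1 => //; first by move=> u [].
  by move=> u; exact: cvg_snd.
- by move=> t; rewrite in01 /= => /fg.
- by [].
Qed.

Lemma path_homotopic_sym f g : path_homotopic f g -> path_homotopic g f.
Proof.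
move=> [H [cH H0 H1]]; exists (H \o (fun u => (1 - u.1, u.2))); split.
- apply: within_comp2 => //.
    by move=> [s t] /= []; rewrite !in_itv /= => s01 t01; split => //; lra.
  apply: continuous_pair; last exact: continuous_proj2.
  by move=> u; apply: cvgB; [exact: cvg_cst|exact: cvg_fst].
- by move=> t /H0[h0 h1] /=; rewrite subr0 subrr.
- have i0 : (0 : R) \in `[0, 1] by rewrite in01 lexx ler01.
  have i1 : (1 : R) \in `[0, 1] by rewrite in01 lexx ler01.
  move=> s s01; have /H1[h0 h1] : 1 - s \in `[0, 1] by move: s01; rewrite !in01; lra.
  rewrite /= h0 h1; have [<- <-] := H0 _ i0; have [<- <-] := H0 _ i1.
  by have [-> ->] := H1 _ i1; have [-> ->] := H1 _ i0.
Qed.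

Lemma path_homotopic_ends f g : path_homotopic f g -> f 0 = g 0 /\ f 1 = g 1.
Proof.
move=> [H [_ H0 H1]].
have i0 : (0 : R) \in `[0, 1] by rewrite in01 lexx ler01.
have i1 : (1 : R) \in `[0, 1] by rewrite in01 lexx ler01.
have [_ <-] := H0 _ i0; have [_ <-] := H0 _ i1.
by have [-> ->] := H1 _ i1.
Qed.

Lemma path_homotopic_trans f g h :
  path_homotopic f g -> path_homotopic g h -> path_homotopic f h.
Proof.
move=> fg; have [e0 e1] := path_homotopic_ends fg.
move: fg => [H [cH H0 H1]] [K [cK K0 K1]].
have cover : `[0 : R, 1] `*` `[0 : R, 1] =
    (`[0, 2^-1] `*` `[0, 1]) `|` (`[2^-1, 1] `*` `[0, 1]).
  apply/seteqP; split=> -[s t] /=; rewrite !in_itv /=.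
    move=> [/andP[s0 s1] ->]; case: (leP s 2^-1) => k; [left|right]; first by rewrite s0.
    by rewrite ltW.
  by case=> -[/andP[h1 h2] h3]; split => //; lra.
exists (fun u => if u.1 <= 2^-1 then H (2 * u.1, u.2) else K (2 * u.1 - 1, u.2)).
split.
- rewrite cover; apply: (@within_glue _ _ _ _
    (H \o (fun u => (2 * u.1 + 0, u.2))) (K \o (fun u => (2 * u.1 + -1, u.2)))).
  + by apply: closed_prod; exact: itv_closed.
  + by apply: closed_prod; exact: itv_closed.
  + apply: within_comp2 => //.
      by move=> [s t] /= []; rewrite !in_itv /= => s01 t01; split => //; lra.
    by apply: continuous_pair; [exact: continuous_affine_fst|exact: continuous_proj2].
  + apply: within_comp2 => //.
      by move=> [s t] /= []; rewrite !in_itv /= => s01 t01; split => //; lra.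
    by apply: continuous_pair; [exact: continuous_affine_fst|exact: continuous_proj2].
  + by move=> [s t] /= []; rewrite in_itv /= addr0 => /andP[_ ->].
  + move=> [s t] /= []; rewrite in_itv /= => /andP[h1 h2] t01.
    case: ifP => h3 //; have -> : s = 2^-1 by lra.
    rewrite divff ?pnatr_eq0 // subrr.
    by have [_ ->] := H0 _ t01; have [-> _] := K0 _ t01.
- move=> t t01 /=; rewrite invr_ge0 ler0n mulr0; split; first by have [] := H0 _ t01.
  case: ifP => k; first by exfalso; move: k; lra.
  by rewrite mulr1 -[X in X - 1]/(1 + 1) addrK; have [] := K0 _ t01.
- move=> s; rewrite in01 => s01 /=; case: ifP => k.
    by apply: H1; rewrite in01; lra.
  by rewrite e0 e1; apply: K1; rewrite in01; move/negbT: k; rewrite -ltNge; lra.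
Qed.

Lemma path_homotopic_cat f f' g g' :
  f 1 = g 0 -> path_homotopic f f' -> path_homotopic g g' ->
  path_homotopic (path_cat f g) (path_cat f' g').
Proof.
move=> e [H [cH H0 H1]] [K [cK K0 K1]].
have cover : `[0 : R, 1] `*` `[0 : R, 1] =
    (`[0, 1] `*` `[0, 2^-1]) `|` (`[0, 1] `*` `[2^-1, 1]).
  apply/seteqP; split=> -[t s] /=; rewrite !in_itv /=.
    move=> [-> /andP[s0 s1]]; case: (leP s 2^-1) => k; [left|right]; first by rewrite s0.
    by rewrite ltW.
  by case=> -[h3 /andP[h1 h2]]; split => //; lra.
exists (fun u => if u.2 <= 2^-1 then H (u.1, 2 * u.2) else K (u.1, 2 * u.2 - 1)).
split.
- rewrite cover; apply: (@within_glue _ _ _ _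
    (H \o (fun u => (u.1, 2 * u.2 + 0))) (K \o (fun u => (u.1, 2 * u.2 + -1)))).
  + by apply: closed_prod; exact: itv_closed.
  + by apply: closed_prod; exact: itv_closed.
  + apply: within_comp2 => //.
      by move=> [s t] /= []; rewrite !in_itv /= => s01 t01; split => //; lra.
    by apply: continuous_pair; [exact: continuous_proj1|exact: continuous_affine_snd].
  + apply: within_comp2 => //.
      by move=> [s t] /= []; rewrite !in_itv /= => s01 t01; split => //; lra.
    by apply: continuous_pair; [exact: continuous_proj1|exact: continuous_affine_snd].
  + by move=> [s t] /= []; rewrite !in_itv /= addr0 => _ /andP[_ ->].
  + move=> [s t] /= [] s01; rewrite in_itv /= => /andP[h1 h2].
    case: ifP => h3 //; have -> : t = 2^-1 by lra.
    rewrite divff ?pnatr_eq0 // subrr.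
    by have [_ ->] := H1 _ s01; have [-> _] := K1 _ s01.
- move=> t; rewrite in01 => t01 /=; rewrite /path_cat; case: ifP => k.
    by apply: H0; rewrite in01; lra.
  by apply: K0; rewrite in01; move/negbT: k; rewrite -ltNge; lra.
- move=> s s01 /=; rewrite /path_cat invr_ge0 ler0n mulr0; split.
    by have [] := H1 _ s01.
  case: ifP => k; first by exfalso; move: k; lra.
  by rewrite mulr1 -[X in X - 1]/(1 + 1) addrK; have [] := K1 _ s01.
Qed.

Lemma path_homotopic_rev f g :
  path_homotopic f g -> path_homotopic (path_rev f) (path_rev g).
Proof.
move=> [H [cH H0 H1]]; exists (H \o (fun u => (u.1, 1 - u.2))); split.
- apply: within_comp2 => //.
    by move=> [s t] /= []; rewrite !in_itv /= => s01 t01; split => //; lra.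
  apply: continuous_pair; first exact: continuous_proj1.
  by move=> u; apply: cvgB; [exact: cvg_cst|exact: cvg_snd].
- by move=> t; rewrite in01 => t01 /=; apply: H0; rewrite in01; lra.
- by move=> s /H1[h0 h1] /=; rewrite /path_rev subr0 subrr.
Qed.

Lemma path_catA f g h : f 1 = g 0 -> g 1 = h 0 ->
  {within `[0, 1], continuous (path_cat (path_cat f g) h)} ->
  path_homotopic (path_cat f (path_cat g h)) (path_cat (path_cat f g) h).
Proof.
move=> fg gh c.
pose p (t : R) := Num.max (2^-1 * t + 0) (Num.max (1 * t + - 4^-1) (2 * t + -1)).
have pE t : 0 <= t <= 1 -> [\/ t <= 2^-1 /\ p t = t / 2,
    [/\ 2^-1 < t, t <= 3/4 & p t = t - 4^-1] | 3/4 < t /\ p t = 2 * t - 1].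
  move=> t01; rewrite /p /Num.max.
  case: (leP t 2^-1) => h1; last case: (leP t (3/4)) => h2.
  - by constructor 1; split=> //; do 2 case: ifP => //; lra.
  - by constructor 2; split=> //; do 2 case: ifP => //; lra.
  - by constructor 3; split=> //; do 2 case: ifP => //; lra.
have cp : continuous p.
  apply: continuous_maxf; last apply: continuous_maxf; exact: continuous_affine.
have ip t : 0 <= t <= 1 -> 0 <= p t <= 1.
  by move=> /[dup] t01 /pE [[? ->]|[? ? ->]|[? ->]]; lra.
have p0 : p 0 = id 0.
  by rewrite /p /Num.max /=; do 2 case: ifP => //; lra.
have p1 : p 1 = id 1.
  by rewrite /p /Num.max /=; do 2 case: ifP => //; lra.
have cid : continuous (@id R) by move=> x; exact: cvg_id.
have := path_reparam c cp cid ip (fun _ => id) p0 p1.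
apply: path_homotopic_trans; apply: path_homotopic_sym.
apply: path_homotopic_eq; first by apply: within_comp1.
move=> t /[dup] t01 /pE /= [[a ->]|[a a' ->]|[a ->]]; rewrite /= /path_cat.
- by rewrite a ifT; [rewrite ifT; [congr f; field|lra]|lra].
- rewrite ifT; last lra.
  rewrite [in RHS]ifF; last by apply/negbTE; rewrite -ltNge.
  rewrite [in RHS]ifT; last lra.
  case: ifP => k; last by congr g; field.
  by exfalso; move: k; lra.
- rewrite ifF; last by apply/negbTE; rewrite -ltNge; lra.
  rewrite [in RHS]ifF; last by apply/negbTE; rewrite -ltNge; lra.
  rewrite [in RHS]ifF; last by apply/negbTE; rewrite -ltNge; lra.
  by [].
Qed.

Lemma path_cat1 f x : f 0 = x -> {within `[0, 1], continuous f} ->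
  path_homotopic (path_cat (fun=> x) f) f.
Proof.
move=> f0 c; pose p (t : R) := Num.max 0 (2 * t + -1).
have cp : continuous p.
  by apply: continuous_maxf; [move=> x0; exact: cvg_cst|exact: continuous_affine].
have ip t : 0 <= t <= 1 -> 0 <= p t <= 1.
  by rewrite /p /Num.max; case: ifP; lra.
have p0 : p 0 = id 0 by rewrite /p /Num.max /=; case: ifP; lra.
have p1 : p 1 = id 1 by rewrite /p /Num.max /=; case: ifP; lra.
have cid : continuous (@id R) by move=> ?; exact: cvg_id.
have := path_reparam c cp cid ip (fun _ => id) p0 p1.
apply: path_homotopic_trans; apply: path_homotopic_sym.
apply: path_homotopic_eq; first by apply: within_comp1.
move=> t t01; rewrite /= /path_cat /p /Num.max; case: ifP => h; case: ifP => h' //.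
- by exfalso; move: h h'; lra.
- by have -> : 2 * t - 1 = 0 by move: h h'; lra.
Qed.

Lemma path_1cat f x : f 1 = x -> {within `[0, 1], continuous f} ->
  path_homotopic (path_cat f (fun=> x)) f.
Proof.
move=> f1 c; pose p (t : R) := Num.min 1 (2 * t + 0).
have cp : continuous p.
  by apply: continuous_minf; [move=> x0; exact: cvg_cst|exact: continuous_affine].
have ip t : 0 <= t <= 1 -> 0 <= p t <= 1.
  by rewrite /p /Num.min; case: ifP; lra.
have p0 : p 0 = id 0 by rewrite /p /Num.min /=; case: ifP; lra.
have p1 : p 1 = id 1 by rewrite /p /Num.min /=; case: ifP; lra.
have cid : continuous (@id R) by move=> ?; exact: cvg_id.
have := path_reparam c cp cid ip (fun _ => id) p0 p1.
apply: path_homotopic_trans; apply: path_homotopic_sym.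
apply: path_homotopic_eq; first by apply: within_comp1.
move=> t t01; rewrite /= /path_cat /p /Num.min addr0; case: ifP => h; case: ifP => h' //.
- by exfalso; move: h h'; lra.
- by have -> : 2 * t = 1 by move: h h'; lra.
Qed.

Lemma path_cat_rev f x : f 0 = x -> {within `[0, 1], continuous f} ->
  path_homotopic (path_cat f (path_rev f)) (fun=> x).
Proof.
move=> f0 c; pose p (t : R) := Num.min (2 * t + 0) ((- 2) * t + 2).
have cp : continuous p by apply: continuous_minf; exact: continuous_affine.
have cq : continuous (fun _ : R => 0 : R) by move=> ?; exact: cvg_cst.
have ip t : 0 <= t <= 1 -> 0 <= p t <= 1 by rewrite /p /Num.min; case: ifP; lra.
have iq (t : R) : 0 <= t <= 1 -> 0 <= (0 : R) <= 1 by lra.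
have p0 : p 0 = 0 by rewrite /p /Num.min /=; case: ifP; lra.
have p1 : p 1 = 0 by rewrite /p /Num.min /=; case: ifP; lra.
have := path_reparam c cp cq ip iq p0 p1; rewrite [f \o fun=> 0]/comp f0.
apply: path_homotopic_trans; apply: path_homotopic_sym.
apply: path_homotopic_eq; first by apply: within_comp1.
move=> t t01; rewrite /= /path_cat /path_rev /p /Num.min addr0.
case: ifP => h; case: ifP => h' //; try (by exfalso; move: h h'; lra).
- by congr f; move: h h'; lra.
- by congr f; ring.
Qed.

End Paths.

Section FundamentalGroup.
Variables (R : realType) (T : topologicalType) (x : T).

Record loop := Loop { loop_fun :> R -> T; loopP : is_path loop_fun x x }.
HB.instance Definition _ := gen_eqMixin loop.
HB.instance Definition _ := gen_choiceMixin loop.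

Lemma loop_cont (f : loop) : {within `[0, 1], continuous f}.
Proof. by case: f => f []. Qed.
Lemma loop_start (f : loop) : f 0 = x. Proof. by case: f => f []. Qed.
Lemma loop_end (f : loop) : f 1 = x. Proof. by case: f => f []. Qed.

Definition loop_rel (f g : loop) : bool := `[< path_homotopic f g >].

Local Lemma loop_refl : reflexive loop_rel.
Proof.
by move=> f; apply/asboolP/path_homotopic_eq => //; case: f => f [].
Qed.

Local Lemma loop_sym : symmetric loop_rel.
Proof.
by move=> f g; apply/idP/idP => /asboolP h; apply/asboolP/path_homotopic_sym.
Qed.

Local Lemma loop_trans : transitive loop_rel.
Proof.
move=> g f h /asboolP fg /asboolP gh; apply/asboolP.
exact: path_homotopic_trans fg gh.
Qed.

Definition loop_equiv := EquivRel loop_rel loop_refl loop_sym loop_trans.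

Definition pi1 := {eq_quot loop_equiv}.
HB.instance Definition _ := Choice.on pi1.
HB.instance Definition _ := Quotient.on pi1.

Definition pi1_class (f : loop) : pi1 := \pi_pi1 f.

Definition loop_cst : loop := Loop (is_path_cst R x).
Definition loop_cat (f g : loop) : loop := Loop (path_catP (loopP f) (loopP g)).
Definition loop_rev (f : loop) : loop := Loop (path_revP (loopP f)).

Definition pi1_one : pi1 := pi1_class loop_cst.
Definition pi1_mul (a b : pi1) : pi1 := pi1_class (loop_cat (repr a) (repr b)).
Definition pi1_inv (a : pi1) : pi1 := pi1_class (loop_rev (repr a)).

Lemma pi1_classP (f g : loop) : pi1_class f = pi1_class g <-> path_homotopic f g.
Proof.
by split=> [/eqmodP /asboolP //|h]; apply/eqmodP/asboolP.
Qed.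

Lemma pi1_surj (a : pi1) : exists f, a = pi1_class f.
Proof. by exists (repr a); rewrite /pi1_class reprK. Qed.

Local Lemma pi1_reprP f : path_homotopic (repr (pi1_class f)) f.
Proof. by apply/pi1_classP; rewrite /pi1_class reprK. Qed.

Local Lemma pi1_mulE f g :
  pi1_mul (pi1_class f) (pi1_class g) = pi1_class (loop_cat f g).
Proof.
apply/pi1_classP/path_homotopic_cat; [|exact: pi1_reprP..].
by rewrite loop_start loop_end.
Qed.

Local Lemma pi1_invE f : pi1_inv (pi1_class f) = pi1_class (loop_rev f).
Proof. exact/pi1_classP/path_homotopic_rev/pi1_reprP. Qed.

Local Lemma pi1_mulA : associative pi1_mul.
Proof.
move=> a b c; have [f ->] := pi1_surj a; have [g ->] := pi1_surj b.
have [h ->] := pi1_surj c; rewrite !pi1_mulE; apply/pi1_classP/path_catA.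
- by rewrite loop_start loop_end.
- by rewrite loop_start loop_end.
- by have [] := path_catP (path_catP (loopP f) (loopP g)) (loopP h).
Qed.

Local Lemma pi1_mul1 : left_id pi1_one pi1_mul.
Proof.
move=> a; have [f ->] := pi1_surj a; rewrite pi1_mulE.
by apply/pi1_classP/path_cat1; [exact: loop_start|exact: loop_cont].
Qed.

Local Lemma pi1_1mul : right_id pi1_one pi1_mul.
Proof.
move=> a; have [f ->] := pi1_surj a; rewrite pi1_mulE.
by apply/pi1_classP/path_1cat; [exact: loop_end|exact: loop_cont].
Qed.

Local Lemma pi1_Vmul : right_inverse pi1_one pi1_inv pi1_mul.
Proof.
move=> a; have [f ->] := pi1_surj a; rewrite pi1_invE pi1_mulE.
by apply/pi1_classP/path_cat_rev; [exact: loop_start|exact: loop_cont].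
Qed.

Local Lemma pi1_invK : involutive pi1_inv.
Proof.
move=> a; have [f ->] := pi1_surj a; rewrite !pi1_invE.
apply/pi1_classP/path_homotopic_sym/path_homotopic_eq; first exact: loop_cont.
by move=> t _; rewrite /= /path_rev subKr.
Qed.

Local Lemma pi1_mulV : left_inverse pi1_one pi1_inv pi1_mul.
Proof. by move=> a; rewrite -{2}(pi1_invK a) pi1_Vmul. Qed.

HB.instance Definition _ :=
  isGroup.Build pi1 pi1_mulA pi1_mul1 pi1_1mul pi1_mulV pi1_Vmul.

Lemma pi1_classM (f g : loop) :
  pi1_class (loop_cat f g) = (pi1_class f * pi1_class g)%g.
Proof. exact/esym/pi1_mulE. Qed.

Lemma pi1_class1 : pi1_class loop_cst = 1%g.
Proof. by []. Qed.

End FundamentalGroup.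

Section Geodesic.
Variables (R : realType) (X : metricType R).

Definition chord_sum (f : R -> X) (a : R) (s : seq R) : R :=
  \sum_(0 <= i < size s) mdist (f (nth a (a :: s) i)) (f (nth a (a :: s) i.+1)).

Definition curve_length (a b : R) (f : R -> X) : \bar R :=
  ereal_sup [set (chord_sum f a s)%:E | s in itv_partition a b].

Definition geodesic_space : Prop :=
  forall x y : X, exists (a b : R) (f : R -> X),
    [/\ a <= b, {within `[a, b], continuous f}, f a = x, f b = y
      & curve_length a b f = (mdist x y)%:E].

End Geodesic.
Arguments geodesic_space {R} X.

Section Chains.
Variables (R : realType) (X : metricType R).
Implicit Types (e d : R) (x y : X) (b c : seq X).

Definition eps_near e : rel X := fun x y => mdist x y < e.

Definition eps_chain e c : bool := (c != [::]) && sorted (eps_near e) c.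

(* The inserted point [z] may be put first or last provided that it repeats
   the endpoint: the moves preserve the endpoints as points of [X], not as
   occurrences, so that for instance the chains [:: x] and [:: x; x] differ
   by a basic move. *)
Definition insertion e b c : Prop :=
  exists s z t,
    [/\ b = s ++ t, c = s ++ z :: t, eps_chain e b, eps_chain e c
      & forall w, head w b = head w c /\ last w b = last w c].

Definition basic_move e b c : Prop := insertion e b c \/ insertion e c b.

Definition eps_homotopic e : seq X -> seq X -> Prop :=
  clos_refl_sym_trans (seq X) (basic_move e).

Definition is_eps_loop e x c : bool :=
  [&& eps_chain e c, head x c == x & last x c == x].

Definition eps_null e x c : Prop := eps_homotopic e c [:: x].

Lemma eps_near_sym e : symmetric (eps_near e).
Proof. by move=> x y; rewrite /eps_near metric_sym. Qed.

Lemma eps_chain_cons e x c : eps_chain e (x :: c) = path (eps_near e) x c.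
Proof. by []. Qed.

Lemma eps_chain_le e d c : e <= d -> eps_chain e c -> eps_chain d c.
Proof.
move=> ed /andP[cn h]; rewrite /eps_chain cn; apply: sub_sorted h => x y xy.
exact: lt_le_trans xy ed.
Qed.

Lemma eps_homotopic_refl e c : eps_homotopic e c c.
Proof. exact: rst_refl. Qed.

Lemma eps_homotopic_sym e b c : eps_homotopic e b c -> eps_homotopic e c b.
Proof. exact: rst_sym. Qed.

Lemma eps_homotopic_trans e a b c :
  eps_homotopic e a b -> eps_homotopic e b c -> eps_homotopic e a c.
Proof. exact: rst_trans. Qed.

Lemma insertion_homotopic e b c : insertion e b c -> eps_homotopic e b c.
Proof. by move=> h; apply: rst_step; left. Qed.

Lemma eps_homotopic_map e e' (P : seq X -> Prop) (f : seq X -> seq X) :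
  (forall b c, insertion e b c -> P b <-> P c) ->
  (forall b c, insertion e b c -> P b -> P c -> eps_homotopic e' (f b) (f c)) ->
  forall b c, eps_homotopic e b c -> P b -> eps_homotopic e' (f b) (f c).
Proof.
move=> hP hf b c h; suff [] : (P b <-> P c) /\ (P b -> eps_homotopic e' (f b) (f c)) by [].
elim: h => [b' c' [|] i|b'|b' c' _ [i j]|a' b' c' _ [i j] _ [i' j']].
- by have q := hP _ _ i; split=> // pb; apply: hf => //; apply/q.
- have q := hP _ _ i; split=> [|pb]; first by split=> /q.
  by apply/eps_homotopic_sym/hf => //; apply/q.
- by split=> // _; exact: eps_homotopic_refl.
- by split=> [|/i /j]; [split=> /i|exact: eps_homotopic_sym].
- split=> [|pa]; first by split=> [/i /i'|/i' /i].
  by apply: eps_homotopic_trans (j pa) (j' _); apply/i.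
Qed.

Lemma eps_homotopic_le e d b c : e <= d ->
  eps_homotopic e b c -> eps_homotopic d b c.
Proof.
move=> ed h; apply: (eps_homotopic_map (P := fun=> True) (f := id)) h _ => //.
move=> b' c' [s [z [t [-> -> h1 h2 h3]]]] _ _; apply: insertion_homotopic.
exists s, z, t; split=> //.
- exact: eps_chain_le ed h1.
- exact: eps_chain_le ed h2.
Qed.

Definition chain_cat b c := b ++ behead c.

Lemma chain_catP e b c : eps_chain e b -> eps_chain e c ->
  (forall w, last w b = head w c) ->
  [/\ eps_chain e (chain_cat b c),
      forall w, head w (chain_cat b c) = head w b
    & forall w, last w (chain_cat b c) = last w c].
Proof.
case: b => [//|x b]; case: c => [//|y c]; rewrite !eps_chain_cons /=.
move=> hb hc /(_ x) E; rewrite -{}E in hc *.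
rewrite /chain_cat /eps_chain /= cat_path hb; split=> // w.
by rewrite last_cat.
Qed.

Lemma eps_homotopic_catr e b c k : eps_homotopic e b c -> eps_chain e k ->
  (forall w, last w b = head w k) ->
  eps_homotopic e (chain_cat b k) (chain_cat c k).
Proof.
move=> h ck; move: b c h; apply: eps_homotopic_map.
  move=> b c [s [z [t [_ _ _ _ h3]]]].
  by split=> h w; rewrite -h; have [_ ->] := h3 w.
move=> b c [s [z [t [eb ec h1 h2 h3]]]] pb pc; apply: insertion_homotopic.
have [k1 k2 k3] := chain_catP h1 ck pb.
have [l1 l2 l3] := chain_catP h2 ck pc.
exists s, z, (t ++ behead k); split=> //.
- by rewrite /chain_cat eb catA.
- by rewrite /chain_cat ec -catA.
- by move=> w; rewrite k2 k3 l2 l3; have [-> _] := h3 w.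
Qed.

Lemma eps_homotopic_catl e b c k : eps_homotopic e b c -> eps_chain e k ->
  (forall w, last w k = head w b) ->
  eps_homotopic e (chain_cat k b) (chain_cat k c).
Proof.
move=> h ck; move: b c h.
apply: (eps_homotopic_map (P := fun b => forall w, last w k = head w b)).
  move=> b c [s [z [t [_ _ _ _ h3]]]].
  by split=> h w; rewrite h; have [-> _] := h3 w.
move=> b c [s [z [t [eb ec h1 h2 h3]]]] pb pc; apply: insertion_homotopic.
have [k1 k2 k3] := chain_catP ck h1 pb.
have [l1 l2 l3] := chain_catP ck h2 pc.
have ends w : head w (chain_cat k b) = head w (chain_cat k c) /\
    last w (chain_cat k b) = last w (chain_cat k c).
  by rewrite k2 k3 l2 l3; have [_ ->] := h3 w.
case: s eb ec => [|y s] /= eb ec; last first.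
  by exists (k ++ s), z, t; split=> //; rewrite /chain_cat ?eb ?ec catA.
case: t eb ec => [|y t] eb ec; first by move: h1; rewrite eb.
exists k, z, t; split=> //; rewrite /chain_cat ?eb ?ec //=.
by have [] := h3 z; rewrite eb ec /= => ->.
Qed.

Lemma eps_chain_rev e c : eps_chain e (rev c) = eps_chain e c.
Proof.
rewrite /eps_chain rev_sorted -!size_eq0 size_rev; congr andb.
by apply: eq_sorted => x y; rewrite /= eps_near_sym.
Qed.

Lemma head_rev_last (w : X) c : head w (rev c) = last w c.
Proof. by case/lastP: c => // c x; rewrite rev_rcons last_rcons. Qed.

Lemma last_rev_head (w : X) c : last w (rev c) = head w c.
Proof. by rewrite -head_rev_last revK. Qed.

Lemma eps_homotopic_rev e b c :
  eps_homotopic e b c -> eps_homotopic e (rev b) (rev c).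
Proof.
move=> h; apply: (eps_homotopic_map (P := fun=> True)) h _ => //.
move=> b' c' [s [z [t [eb ec h1 h2 h3]]]] _ _; apply: insertion_homotopic.
exists (rev t), z, (rev s); split; rewrite ?eps_chain_rev //.
- by rewrite eb rev_cat.
- by rewrite ec rev_cat rev_cons cat_rcons.
- by move=> w; rewrite !head_rev_last !last_rev_head; have [] := h3 w.
Qed.

Lemma insert_homotopic e s z t :
  s != [::] -> t != [::] -> eps_chain e (s ++ t) -> eps_chain e (s ++ z :: t) ->
  eps_homotopic e (s ++ t) (s ++ z :: t).
Proof.
move=> sn tn h1 h2; apply: insertion_homotopic; exists s, z, t; split=> // w.
by case: s sn {h1 h2} => // x s _; case: t tn => // y t _; rewrite /= !last_cat.
Qed.

Lemma eps_null_cat_rev e c : eps_chain e c -> c != [::] ->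
  forall w, eps_homotopic e (chain_cat c (rev c)) [:: head w c].
Proof.
case: c => // x s; elim: s x => [|y s IHs] x; first by move=> _ _ w; exact: eps_homotopic_refl.
rewrite eps_chain_cons => hxys _ w; have /= /andP[xy ys] := hxys.
have {}IHs := IHs y ys isT w.
pose k := chain_cat (y :: s) (rev (y :: s)).
have kE : chain_cat [:: x, y & s] (rev [:: x, y & s]) =
    chain_cat [:: x; y] (chain_cat k [:: y; x]).
  rewrite /k /chain_cat /= [rev [:: x, y & s]]rev_cons.
  have : rev (y :: s) != [::] by rewrite -size_eq0 size_rev.
  by case: (rev _) => // z u _ /=; rewrite cats1 rcons_cat.
have yk : eps_chain e [:: y; x] by rewrite eps_chain_cons /= eps_near_sym xy.
have xk : eps_chain e [:: x; y] by rewrite eps_chain_cons /= xy.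
have rk : eps_chain e (rev (y :: s)) by rewrite eps_chain_rev.
have cy : forall v, last v (y :: s) = head v (rev (y :: s)).
  by move=> v; rewrite head_rev_last.
have [k1 k2 k3] := @chain_catP e (y :: s) _ ys rk cy.
have lk v : last v k = y by rewrite k3 last_rev_head.
rewrite kE; apply: (@eps_homotopic_trans e _ (chain_cat [:: x; y] (chain_cat [:: y] [:: y; x]))).
  apply: eps_homotopic_catl => //; exact: eps_homotopic_catr.
rewrite /chain_cat /=.
have e0 : eps_near e x x by rewrite /eps_near mdistxx (le_lt_trans _ xy) ?mdist_ge0.
apply: (@eps_homotopic_trans e _ [:: x; x]); apply: eps_homotopic_sym.
  apply: (@insert_homotopic e [:: x] y [:: x]) => //.
    by rewrite eps_chain_cons /= e0.
  by rewrite eps_chain_cons /= xy eps_near_sym xy.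
apply: insertion_homotopic; exists [:: x], x, [::]; split=> //.
by rewrite eps_chain_cons /= e0.
Qed.

End Chains.

Section PiEps.
Variables (R : realType) (X : metricType R) (e : R) (x : X).

Record eps_loop :=
  EpsLoop { eps_loop_seq :> seq X; eps_loopP : is_eps_loop e x eps_loop_seq }.
HB.instance Definition _ := [isSub for eps_loop_seq].
HB.instance Definition _ := [Choice of eps_loop by <:].

Implicit Types b c : eps_loop.

Lemma eps_loop_chain c : eps_chain e c.
Proof. by case/and3P: (eps_loopP c). Qed.

Lemma eps_loop_head c w : head w c = x.
Proof. by case/and3P: (eps_loopP c) => /andP[+ _] /eqP + _; case: (val c). Qed.

Lemma eps_loop_last c w : last w c = x.
Proof. by case/and3P: (eps_loopP c) => /andP[+ _] _ /eqP; case: (val c). Qed.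

Definition eps_loop_rel b c : bool := `[< eps_homotopic e b c >].

Local Lemma eps_loop_refl : reflexive eps_loop_rel.
Proof. by move=> c; apply/asboolP/eps_homotopic_refl. Qed.

Local Lemma eps_loop_sym : symmetric eps_loop_rel.
Proof.
by move=> b c; apply/idP/idP => /asboolP h; apply/asboolP/eps_homotopic_sym.
Qed.

Local Lemma eps_loop_trans : transitive eps_loop_rel.
Proof.
move=> b a c /asboolP ab /asboolP bc; apply/asboolP.
exact: eps_homotopic_trans ab bc.
Qed.

Definition eps_loop_equiv :=
  EquivRel eps_loop_rel eps_loop_refl eps_loop_sym eps_loop_trans.

Definition pi_eps := {eq_quot eps_loop_equiv}.
HB.instance Definition _ := Choice.on pi_eps.
HB.instance Definition _ := Quotient.on pi_eps.

Definition eps_class c : pi_eps := \pi_pi_eps c.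

Local Fact eps_loop1_proof : is_eps_loop e x [:: x].
Proof. by rewrite /is_eps_loop /= eqxx. Qed.

Local Fact eps_loop_cat_proof b c : is_eps_loop e x (chain_cat b c).
Proof.
have [h1 h2 h3] : [/\ eps_chain e (chain_cat b c),
    forall w, head w (chain_cat b c) = head w b
    & forall w, last w (chain_cat b c) = last w c].
  apply: chain_catP; rewrite ?eps_loop_chain // => w.
  by rewrite eps_loop_head eps_loop_last.
by rewrite /is_eps_loop h1 h2 h3 eps_loop_head eps_loop_last eqxx.
Qed.

Local Fact eps_loop_rev_proof c : is_eps_loop e x (rev c).
Proof.
rewrite /is_eps_loop eps_chain_rev head_rev_last last_rev_head eps_loop_chain.
by rewrite eps_loop_head eps_loop_last eqxx.
Qed.

Definition eps_loop1 := EpsLoop eps_loop1_proof.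
Definition eps_loop_cat b c := EpsLoop (eps_loop_cat_proof b c).
Definition eps_loop_rev c := EpsLoop (eps_loop_rev_proof c).

Definition pi_eps_one : pi_eps := eps_class eps_loop1.
Definition pi_eps_mul (g h : pi_eps) : pi_eps :=
  eps_class (eps_loop_cat (repr g) (repr h)).
Definition pi_eps_inv (g : pi_eps) : pi_eps := eps_class (eps_loop_rev (repr g)).

Lemma eps_classP b c : eps_class b = eps_class c <-> eps_homotopic e b c.
Proof. by split=> [/eqmodP /asboolP //|h]; apply/eqmodP/asboolP. Qed.

Lemma eps_class_surj (g : pi_eps) : exists c, g = eps_class c.
Proof. by exists (repr g); rewrite /eps_class reprK. Qed.

Lemma eps_class_repr c : eps_homotopic e (repr (eps_class c)) c.
Proof. by apply/eps_classP; rewrite /eps_class reprK. Qed.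

Local Lemma pi_eps_mulE b c :
  pi_eps_mul (eps_class b) (eps_class c) = eps_class (eps_loop_cat b c).
Proof.
apply/eps_classP => /=; set b' := repr _; set c' := repr _.
apply: (@eps_homotopic_trans _ _ e _ (chain_cat b c')).
  apply: eps_homotopic_catr; rewrite ?eps_loop_chain //.
    exact: eps_class_repr.
  by move=> w; rewrite eps_loop_head eps_loop_last.
apply: eps_homotopic_catl; rewrite ?eps_loop_chain //.
  exact: eps_class_repr.
by move=> w; rewrite eps_loop_head eps_loop_last.
Qed.

Local Lemma pi_eps_invE c : pi_eps_inv (eps_class c) = eps_class (eps_loop_rev c).
Proof. exact/eps_classP/eps_homotopic_rev/eps_class_repr. Qed.

Local Lemma eps_class_eq b c : b = c :> seq X -> eps_class b = eps_class c.
Proof. by move=> bc; congr eps_class; apply: val_inj. Qed.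

Local Lemma pi_eps_mulA : associative pi_eps_mul.
Proof.
move=> f g h; have [a ->] := eps_class_surj f; have [b ->] := eps_class_surj g.
have [c ->] := eps_class_surj h; rewrite !pi_eps_mulE; apply: eps_class_eq.
rewrite /= /chain_cat; have := eps_loop_chain b; case: (val b) => //= z s _.
by rewrite catA.
Qed.

Local Lemma pi_eps_mul1 : left_id pi_eps_one pi_eps_mul.
Proof.
move=> g; have [c ->] := eps_class_surj g; rewrite pi_eps_mulE.
apply: eps_class_eq; rewrite /= /chain_cat; have := eps_loop_chain c.
by have := eps_loop_head c x; case: (val c) => //= z s ->.
Qed.

Local Lemma pi_eps_1mul : right_id pi_eps_one pi_eps_mul.
Proof.
move=> g; have [c ->] := eps_class_surj g; rewrite pi_eps_mulE.
by apply: eps_class_eq; rewrite /= /chain_cat cats0.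
Qed.

Local Lemma pi_eps_Vmul : right_inverse pi_eps_one pi_eps_inv pi_eps_mul.
Proof.
move=> g; have [c ->] := eps_class_surj g; rewrite pi_eps_invE pi_eps_mulE.
apply/eps_classP => /=; have cn : (c : seq X) != [::].
  by case/andP: (eps_loop_chain c).
by have := eps_null_cat_rev (eps_loop_chain c) cn x; rewrite eps_loop_head.
Qed.

Local Lemma pi_eps_invK : involutive pi_eps_inv.
Proof.
move=> g; have [c ->] := eps_class_surj g; rewrite !pi_eps_invE.
by apply: eps_class_eq; rewrite /= revK.
Qed.

Local Lemma pi_eps_mulV : left_inverse pi_eps_one pi_eps_inv pi_eps_mul.
Proof. by move=> g; rewrite -{2}(pi_eps_invK g) pi_eps_Vmul. Qed.

HB.instance Definition _ := isGroup.Build pi_eps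
  pi_eps_mulA pi_eps_mul1 pi_eps_1mul pi_eps_mulV pi_eps_Vmul.

Lemma eps_classM b c :
  eps_class (eps_loop_cat b c) = (eps_class b * eps_class c)%g.
Proof. exact/esym/pi_eps_mulE. Qed.

Lemma eps_class1 : eps_class eps_loop1 = 1%g.
Proof. by []. Qed.

End PiEps.

Section StrongChains.
Variables (R : realType) (X : metricType R).
Implicit Types (e d : R) (f g : R -> X) (a b t : R) (s u v w : seq R).

Definition strong_step e f : rel R := fun t t' =>
  `[< f @` `[t, t'] `<=` ball (f t) e `&` ball (f t') e >].

Definition strong_partition e f a b s : Prop :=
  itv_partition a b s /\ path (strong_step e f) a s.

Definition strong_chain e f a b (c : seq X) : Prop :=
  exists2 s, strong_partition e f a b s & c = map f (a :: s).

Local Lemma lt_path_le_last a s : path <%R a s -> a <= last a s.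
Proof.
elim: s a => //= y s IHs a /andP[ay /IHs]; exact/le_trans/ltW.
Qed.

Local Lemma lt_path_mem_gt a s t : path <%R a s -> t \in s -> a < t.
Proof. by move=> /(order_path_min lt_trans)/allP; exact. Qed.

Local Lemma lt_path_mem_le a s t : path <%R a s -> t \in a :: s -> t <= last a s.
Proof.
elim: s a => [|y s IHs] a /=; first by move=> _; rewrite inE => /eqP ->.
move=> /andP[ay ys]; rewrite inE => /predU1P[->|]; last exact: IHs.
exact: le_trans (ltW ay) (lt_path_le_last ys).
Qed.

Lemma strong_partition_chain e f a b s :
  strong_partition e f a b s -> eps_chain e (map f (a :: s)).
Proof.
move=> [[s1 _] s2]; rewrite eps_chain_cons path_map.
elim: s a s1 s2 => //= y s IHs a /andP[ay ys] /andP[/asboolP h hs].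
rewrite IHs // andbT /eps_near.
have /h[+ _] : (f @` `[a, y]) (f y) by exists y => //=; rewrite in_itv /= lexx ltW.
by rewrite ballEmdist.
Qed.

Let right_step e f : rel R := fun t t' =>
  `[< forall z, t <= z <= t' -> eps_near e (f z) (f t') >].

Local Lemma strong_right_step e f t t' : strong_step e f t t' -> right_step e f t t'.
Proof.
move=> /asboolP h; apply/asboolP => z zt.
have /h[_] : (f @` `[t, t']) (f z) by exists z => //=; rewrite in_itv.
by rewrite eps_near_sym ballEmdist.
Qed.

Local Lemma hom_cons e (x y : X) (b c : seq X) :
  eps_homotopic e (y :: b) (y :: c) -> eps_near e x y ->
  eps_homotopic e [:: x, y & b] [:: x, y & c].
Proof.
move=> h xy; apply: (eps_homotopic_catl (k := [:: x; y]) h) => //.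
by rewrite eps_chain_cons /= xy.
Qed.

Lemma refine_homotopic e f a s u :
  path <%R a s -> path <%R a u -> {subset s <= u} -> last a s = last a u ->
  path (strong_step e f) a s -> eps_chain e (map f (a :: u)) ->
  eps_homotopic e (map f (a :: s)) (map f (a :: u)).
Proof.
move=> s1 u1 su l /(sub_path (@strong_right_step e f)) s2.
elim: u a s s1 u1 su l s2 => [|y u IHu] a s s1 u1 su l s2.
  by case: s s1 su l s2 => [|z s] _ su _ _ *; [exact: eps_homotopic_refl|have := su z (mem_head _ _)].
case: s s1 su l s2 => [|z s] s1 su l s2 c.
  have := lt_path_le_last (andP u1).2; rewrite -/(last y u).
  by move: l => /= <-; move: u1 => /= /andP[/lt_geF ->].
move: (s1) (u1) (s2) => /= /andP[az zs] /andP[ay yu] /andP[rz rs].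
have /andP[cy cu] : path (eps_near e) (f a) (map f (y :: u)) by [].
have [zy|zy] := eqVneq z y.
  subst z; apply: hom_cons => //; suff su' : {subset s <= u} by exact: (IHu y s zs yu su' l rs cu).
  move=> t ts; have := su t; rewrite !inE ts orbT => /(_ isT) /predU1P[ty|//].
  by have := lt_path_mem_gt zs ts; rewrite ty ltxx.
have zu : z \in u by have := su z (mem_head _ _); rewrite inE (negbTE zy).
have yz := lt_path_mem_gt yu zu.
have nyz : eps_near e (f y) (f z) by move/asboolP: rz; apply; rewrite !ltW.
have ryz : path (right_step e f) y (z :: s).
  rewrite /= rs andbT; apply/asboolP => r /andP[r1 r2]; move/asboolP: rz; apply.
  by rewrite r2 (le_trans _ r1) // ltW.
have su' : {subset z :: s <= u}.
  move=> t; rewrite inE => /predU1P[->//|ts].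
  have := su t; rewrite !inE ts orbT => /(_ isT) /predU1P[ty|//].
  by have := lt_trans yz (lt_path_mem_gt zs ts); rewrite ty ltxx.
have yzs : path <%R y (z :: s) by rewrite /= yz.
have h := IHu y (z :: s) yzs yu su' l ryz cu.
apply: eps_homotopic_trans (hom_cons h cy).
have cs : eps_chain e (map f (z :: s)).
  rewrite eps_chain_cons path_map; move: rs zs; clear; elim: s z => //= y s IHs z.
  move=> /andP[/asboolP h rs] /andP[zy ys]; rewrite IHs // andbT.
  by apply: h; rewrite lexx ltW.
have naz : eps_near e (f a) (f z) by move/asboolP: rz; apply; rewrite lexx ltW.
apply: (@insert_homotopic _ _ e [:: f a] (f y) (map f (z :: s))) => //.
  by rewrite /= eps_chain_cons /= naz.
by rewrite /= eps_chain_cons /= cy nyz.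
Qed.

Local Lemma ladder e f g a u :
  eps_chain e (map f (a :: u)) -> eps_chain e (map g (a :: u)) ->
  {in a :: u, forall t, eps_near e (f t) (g t)} ->
  path (fun t t' => eps_near e (f t) (g t')) a u ->
  f (last a u) = g (last a u) ->
  eps_homotopic e (map f (a :: u)) (f a :: map g (a :: u)).
Proof.
elim: u a => [|y u IHu] a cf cg fg q l.
  apply: insertion_homotopic; exists [:: f a], (g a), [::]; split=> //=.
  by rewrite eps_chain_cons /= fg ?mem_head.
move: (q) => /= /andP[q1 q2].
have /andP[cf1 cf2] : path (eps_near e) (f a) (map f (y :: u)) by [].
have /andP[cg1 cg2] : path (eps_near e) (g a) (map g (y :: u)) by [].
have fg' : {in y :: u, forall t, eps_near e (f t) (g t)}.
  by move=> t tu; apply: fg; rewrite inE tu orbT.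
have h := hom_cons (IHu y cf2 cg2 fg' q2 l) cf1.
have c1 : eps_chain e [:: f a, g y & map g u] by rewrite eps_chain_cons /= q1.
apply: (eps_homotopic_trans h).
apply: (@eps_homotopic_trans _ _ e _ [:: f a, g y & map g u]).
  apply: eps_homotopic_sym.
  apply: (@insert_homotopic _ _ e [:: f a] (f y) (g y :: map g u)) => //.
  by rewrite /= eps_chain_cons /= cf1 fg' ?mem_head.
apply: (@insert_homotopic _ _ e [:: f a] (g a) (g y :: map g u)) => //.
by rewrite /= eps_chain_cons /= cg1 fg ?mem_head.
Qed.

Local Lemma ladder_eq e f g a u :
  eps_chain e (map f (a :: u)) -> eps_chain e (map g (a :: u)) ->
  {in a :: u, forall t, eps_near e (f t) (g t)} ->
  path (fun t t' => eps_near e (f t) (g t')) a u ->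
  f a = g a -> f (last a u) = g (last a u) ->
  eps_homotopic e (map f (a :: u)) (map g (a :: u)).
Proof.
move=> cf cg fg q fa l; apply: (eps_homotopic_trans (ladder cf cg fg q l)).
apply/eps_homotopic_sym/insertion_homotopic.
exists [::], (f a), (map g (a :: u)); split=> //=.
by rewrite eps_chain_cons /= fg ?mem_head.
Qed.

Let gap d : rel R := fun t t' => t' - t < d.

Local Lemma subdivide d a b : 0 < d -> a < b ->
  exists s, [/\ path <%R a s, last a s = b & path (gap d) a s].
Proof.
move=> d0 ab; have [n] : exists n : nat, b - a < n%:R * (d / 2).
  exists (Num.truncn ((b - a) / (d / 2))).+1.
  by rewrite -ltr_pdivrMr ?divr_gt0 // truncnS_gt.
elim: n a ab => [|n IHn] a ab h; first by move: h; rewrite mul0r; lra.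
case: (ltP (b - a) d) => k; first by exists [:: b]; rewrite /= /gap ab k.
have [||s [s1 s2 s3]] := IHn (a + d / 2); first lra.
  by move: h; rewrite -natr1 mulrDl mul1r; lra.
by exists (a + d / 2 :: s); rewrite /= s1 s3 /gap; split=> //; lra.
Qed.

Local Lemma refine_gap d a u : 0 < d -> path <%R a u ->
  exists w, [/\ path <%R a w, {subset u <= w}, last a w = last a u
    & path (gap d) a w].
Proof.
move=> d0; elim: u a => [|y u IHu] a /=; first by exists [::].
move=> /andP[ay /IHu[w [w1 w2 w3 w4]]].
have [s [s1 s2 s3]] := subdivide d0 ay; exists (s ++ w); split.
- by rewrite cat_path s1 s2.
- move=> t; rewrite inE mem_cat => /predU1P[->|/w2 ->]; last by rewrite orbT.
  have : y \in a :: s by rewrite -s2 mem_last.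
  by rewrite inE => /predU1P[ya|->//]; move: ay; rewrite ya ltxx.
- by rewrite last_cat s2.
- by rewrite cat_path s3 s2.
Qed.

Let fine_step d : rel R := fun t t' => [&& 0 <= t, t <= t', t' <= 1 & t' - t < d].

Local Lemma fine_path d a w : 0 <= a -> path <%R a w -> last a w <= 1 ->
  path (gap d) a w -> path (fine_step d) a w.
Proof.
elim: w a => //= y w IHw a a0 /andP[ay yw] l /andP[g gw].
rewrite /fine_step a0 (ltW ay) -/(gap d a y) g andbT /= (le_trans (lt_path_le_last yw) l) /=.
by apply: IHw => //; exact: le_trans a0 (ltW ay).
Qed.

Local Lemma unif_cont (S : pseudoMetricType R) (A : set S) (F : S -> X) e :
  compact A -> {within A, continuous F} -> 0 < e ->
  exists2 d, 0 < d & forall p q, A p -> A q -> ball p d q -> eps_near e (F p) (F q).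
Proof.
move=> /compact_near_coveringP/near_covering_withinP cA /subspace_continuousP cF e0.
have := cA R (0^'+)
  (fun d p => forall q, A q -> ball p d q -> eps_near e (F p) (F q)) _.
case.
  move=> p Ap; have e2 : 0 < e / 2 by lra.
  have := cF p Ap _ (nbhsx_ballx (F p) _ e2).
  move=> /nbhs_ballP[r /= r0 hr].
  exists (ball p (r / 2), [set d | 0 < d < r / 2]) => /=.
    split; first by apply: nbhsx_ballx; lra.
    have r2 : 0 < r / 2 by lra.
    near=> d; apply/andP; split; near: d; first exact: nbhs_right_gt.
    exact: nbhs_right_lt.
  move=> [p' d] /= [pp' /andP[d0 dr]] Ap' q Aq pq.
  have k1 : ball (F p) (e / 2) (F p').
    by apply: hr => //; apply: le_ball pp'; lra.
  have k2 : ball (F p) (e / 2) (F q).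
    apply: hr => //; have -> : r = r / 2 + r / 2 by lra.
    by apply: ball_triangle pp' _; apply: le_ball pq; lra.
  rewrite /eps_near; move: k1 k2; rewrite !ballEmdist /= => k1 k2.
  by have := metric_triangle (F p') (F p) (F q); rewrite (metric_sym (F p') (F p)); lra.
move=> d /= d0 hd; exists (d / 2); first by rewrite divr_gt0.
move=> p q Ap Aq pq; apply: (hd (d / 2)) => //=; last by rewrite divr_gt0.
  by rewrite sub0r normrN gtr0_norm ?divr_gt0 // ltr_pdivrMr // ltr_pMr // ltr1n.
Unshelve. all: by end_near.
Qed.

Local Lemma unif_cont01 e f : {within `[0, 1], continuous f} -> 0 < e ->
  exists2 d, 0 < d & forall t t', fine_step d t t' ->
    forall z z', t <= z <= t' -> t <= z' <= t' -> eps_near e (f z) (f z').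
Proof.
move=> cf e0; have [d d0 h] := unif_cont (@segment_compact R 0 1) cf e0.
exists d => // t t' /and4P[t0 tt' t1 td] z z' zt zt'; apply: h.
- by rewrite /= in_itv /=; lra.
- by rewrite /= in_itv /=; lra.
- by rewrite /ball /= ltr_norml; lra.
Qed.

Local Lemma fine_strong e f d w :
  (forall t t', fine_step d t t' ->
    forall z z', t <= z <= t' -> t <= z' <= t' -> eps_near e (f z) (f z')) ->
  path <%R 0 w -> last 0 w = 1 -> path (gap d) 0 w ->
  strong_partition e f 0 1 w.
Proof.
move=> h w1 w2 w3; split; first by split=> //; rewrite w2.
have /(fine_path (lexx 0) w1)/(_ w3) : last 0 w <= 1 by rewrite w2.
apply: sub_path => t t' tt'; apply/asboolP => y [z /=]; rewrite in_itv /= => zt <- {y}.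
have /and4P[_ le _ _] := tt'; rewrite !ballEmdist.
by split; apply: (h _ _ tt') => //; rewrite lexx le.
Qed.

Lemma strong_partition_exists e f : {within `[0, 1], continuous f} -> 0 < e ->
  exists s, strong_partition e f 0 1 s.
Proof.
move=> cf e0; have [d d0 h] := unif_cont01 cf e0.
have [s [s1 s2 s3]] := subdivide d0 (@ltr01 R).
by exists s; exact: fine_strong h _ _ _.
Qed.

Lemma strong_chain_unique e f s s' : {within `[0, 1], continuous f} -> 0 < e ->
  strong_partition e f 0 1 s -> strong_partition e f 0 1 s' ->
  eps_homotopic e (map f (0 :: s)) (map f (0 :: s')).
Proof.
move=> cf e0 [[s1 /eqP s2] s3] [[s1' /eqP s2'] s3'].
pose u := sort <=%R (undup (s ++ s')).
have uE t : (t \in u) = (t \in s) || (t \in s').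
  by rewrite mem_sort mem_undup mem_cat.
have u1 : path <%R 0 u.
  rewrite path_sortedE; last exact: lt_trans.
  rewrite sort_lt_sorted undup_uniq andbT; apply/allP => t; rewrite uE.
  by case/orP; exact: lt_path_mem_gt.
have one : 1 \in s.
  have : last 0 s \in 0 :: s by rewrite mem_last.
  by rewrite s2 inE oner_eq0.
have u2 : last 0 u = 1.
  apply/eqP; rewrite eq_le lt_path_mem_le // ?inE ?uE ?one ?orbT // andbT.
  have : last 0 u \in 0 :: u by rewrite mem_last.
  rewrite inE uE => /or3P[/eqP->//|k|k].
    by rewrite -s2 lt_path_mem_le // inE k orbT.
  by rewrite -s2' lt_path_mem_le // inE k orbT.
have [d d0 h] := unif_cont01 cf e0.
have [w [w1 w2 w3 w4]] := refine_gap d0 u1; rewrite u2 in w3.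
have cw := strong_partition_chain (fine_strong h w1 w3 w4).
apply: (@eps_homotopic_trans _ _ e _ (map f (0 :: w))).
  apply: refine_homotopic => //; last by rewrite s2 w3.
  by move=> t ts; apply: w2; rewrite uE ts.
apply/eps_homotopic_sym/refine_homotopic => //; last by rewrite s2' w3.
by move=> t ts; apply: w2; rewrite uE ts orbT.
Qed.

Lemma strong_chain_homotopic e f g : path_homotopic f g -> 0 < e ->
  exists s, [/\ strong_partition e f 0 1 s, strong_partition e g 0 1 s
    & eps_homotopic e (map f (0 :: s)) (map g (0 :: s))].
Proof.
move=> [H [cH H0 H1]] e0.
have [d d0 h] := unif_cont (compact_setX (@segment_compact R 0 1) (@segment_compact R 0 1)) cH e0.
have hH r r' t t' : 0 <= r <= 1 -> 0 <= r' <= 1 -> 0 <= t <= 1 -> 0 <= t' <= 1 ->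
    `|r - r'| < d -> `|t - t'| < d -> eps_near e (H (r, t)) (H (r', t')).
  by move=> *; apply: h => //; split; rewrite //= in_itv.
have [s [s1 s2 s3]] := subdivide d0 (@ltr01 R).
have fs := fine_path (lexx 0) s1 (eq_ind_r (fun z => z <= 1) (lexx 1) s2) s3.
have strong (k : R -> X) r : 0 <= r <= 1 ->
    (forall t, 0 <= t <= 1 -> k t = H (r, t)) -> strong_partition e k 0 1 s.
  move=> r01 kH; apply: (@fine_strong e k d) => // t t' /and4P[t0 tt' t1 td] z z' zt zt'.
  rewrite !kH; [|lra|lra]; apply: hH => //; try lra; first by rewrite subrr normr0.
  by rewrite ltr_norml; lra.
have i0 : 0 <= (0 : R) <= 1 by lra.
have i1 : 0 <= (1 : R) <= 1 by lra.
have fE t : 0 <= t <= 1 -> f t = H (0, t) by rewrite -in01 => /H0[].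
have gE t : 0 <= t <= 1 -> g t = H (1, t) by rewrite -in01 => /H0[].
have sf := strong _ _ i0 fE; have sg := strong _ _ i1 gE.
exists s; split=> //.
have in_s t : t \in 0 :: s -> 0 <= t <= 1.
  move=> ts; rewrite -s2 lt_path_mem_le // andbT.
  by move: ts; rewrite inE => /predU1P[->//|/(lt_path_mem_gt s1)/ltW].
pose C r := map (fun t => H (r, t)) (0 :: s).
have stepC r r' : fine_step d r r' -> eps_homotopic e (C r) (C r').
  move=> /and4P[r0 rr' r1 rd].
  have r01 : 0 <= r <= 1 by lra.
  have r01' : 0 <= r' <= 1 by lra.
  have [e0r e1r] : H (r, 0) = f 0 /\ H (r, 1) = f 1 by apply: H1; rewrite in01.
  have [e0r' e1r'] : H (r', 0) = f 0 /\ H (r', 1) = f 1 by apply: H1; rewrite in01.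
  have nr : `|r - r'| < d by rewrite ltr_norml; lra.
  apply: ladder_eq.
  - exact: strong_partition_chain (strong _ _ r01 (fun _ _ => erefl)).
  - exact: strong_partition_chain (strong _ _ r01' (fun _ _ => erefl)).
  - by move=> t /in_s t01; apply: hH => //; rewrite subrr normr0.
  - apply: sub_path fs => t t' /and4P[t0 tt' t1 td]; apply: hH => //; try lra.
    by rewrite ltr_norml; lra.
  - by rewrite e0r e0r'.
  - by rewrite s2 e1r e1r'.
have CC a w : path (fine_step d) a w -> eps_homotopic e (C a) (C (last a w)).
  elim: w a => [|y w IHw] a /=; first by move=> _; exact: eps_homotopic_refl.
  by move=> /andP[/stepC ay /IHw]; exact: eps_homotopic_trans.
have := CC _ _ fs; rewrite s2.
rewrite (_ : C 0 = map f (0 :: s)); last by apply/eq_in_map => t /in_s /fE.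
by rewrite (_ : C 1 = map g (0 :: s)) //; apply/eq_in_map => t /in_s /gE.
Qed.

Lemma strong_partition_cat e f g s s' : f 1 = g 0 ->
  strong_partition e f 0 1 s -> strong_partition e g 0 1 s' ->
  exists2 v, strong_partition e (path_cat f g) 0 1 v
    & map (path_cat f g) (0 :: v) = chain_cat (map f (0 :: s)) (map g (0 :: s')).
Proof.
move=> fg [[s1 /eqP s2] s3] [[s1' /eqP s2'] s3'].
have cf t : t <= 1 -> path_cat f g (t / 2) = f t.
  by move=> t1; rewrite /path_cat ifT; [congr f; field|lra].
have cg t : 0 <= t -> path_cat f g ((1 + t) / 2) = g t.
  move=> t0; rewrite /path_cat; case: ifP => k; last by congr g; field.
  have -> : t = 0 by move: k; lra.
  by rewrite addr0 -fg; congr f; field.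
pose v1 := [seq t / 2 | t <- s]; pose v2 := [seq (1 + t) / 2 | t <- s'].
have l1 : last 0 v1 = 2^-1.
  by have := last_map (fun t : R => t / 2) s 0; rewrite /= s2 mul0r mul1r.
have p1 r : path r 0 v1 = path (fun t t' => r (t / 2) (t' / 2)) 0 s.
  by have := @path_map R R (fun t : R => t / 2) r 0 s; rewrite /= mul0r.
have p2 r : path r 2^-1 v2 = path (fun t t' => r ((1 + t) / 2) ((1 + t') / 2)) 0 s'.
  by have := @path_map R R (fun t : R => (1 + t) / 2) r 0 s'; rewrite /= addr0 mul1r.
exists (v1 ++ v2); first split; first split.
- rewrite cat_path l1 p1 p2; apply/andP; split.
    by apply: sub_path s1 => t t'; lra.
  by apply: sub_path s1' => t t'; lra.
- rewrite last_cat l1; have := last_map (fun t : R => (1 + t) / 2) s' 0.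
  by rewrite /= addr0 mul1r s2' -[1 + 1]/(2%:R) divff ?pnatr_eq0 // => ->.
- rewrite cat_path l1 p1 p2; apply/andP; split.
    have q : path (fun t t' : R => (t <= t') && (t' <= 1)) 0 s.
      have : last 0 s <= 1 by rewrite s2.
      elim: s (0 : R) s1 {s2 s3 v1 l1 p1} => //= y s IHs a /andP[ay ys] l.
      by rewrite (ltW ay) IHs // andbT (le_trans (lt_path_le_last ys)).
    have : path [rel t t' | ((t <= t') && (t' <= 1)) && strong_step e f t t'] 0 s.
      by rewrite path_relI q.
    apply: sub_path => t t' /= /andP[/andP[tt' t1] /asboolP h]; apply/asboolP.
    move=> y [z /=]; rewrite in_itv /= => zt <- {y}.
    rewrite !cf; [|lra|lra].
    have -> : z = (2 * z) / 2 by field.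
    rewrite cf; last lra.
    by apply: h; exists (2 * z) => //=; rewrite in_itv /=; lra.
  have q a : 0 <= a -> path <%R a s' -> path (fun t t' : R => (0 <= t) && (t <= t')) a s'.
    elim: (s') a => //= y u IHu a a0 /andP[ay yu].
    by rewrite a0 (ltW ay) IHu // (le_trans a0) // ltW.
  have : path [rel t t' | ((0 <= t) && (t <= t')) && strong_step e g t t'] 0 s'.
    by rewrite path_relI (q _ (lexx 0) s1').
  apply: sub_path => t t' /= /andP[/andP[t0 tt'] /asboolP h]; apply/asboolP.
  move=> y [z /=]; rewrite in_itv /= => zt <- {y}.
  rewrite !cg; [|lra|lra].
  have -> : z = (1 + (2 * z - 1)) / 2 by field.
  rewrite cg; last lra.
  by apply: h; exists (2 * z - 1) => //=; rewrite in_itv /=; lra.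
rewrite /chain_cat /= map_cat -!map_comp; congr cons.
  by rewrite -(mul0r 2^-1) cf // mul0r.
congr cat; apply/eq_in_map => t ts /=.
  by apply: cf; rewrite -s2 lt_path_mem_le // inE ts orbT.
by apply: cg; rewrite ltW // (lt_path_mem_gt s1').
Qed.

End StrongChains.

Section Projections.
Variables (R : realType) (X : metricType R) (x : X).

Fact strong_loop_proof (e : R) (f : loop R x) s :
  strong_partition e f 0 1 s -> is_eps_loop e x (map f (0 :: s)).
Proof.
move=> h; rewrite /is_eps_loop (strong_partition_chain h) /= loop_start eqxx /=.
rewrite -[X in last X _](loop_start f) last_map.
by case: h => -[_ /eqP ->] _; rewrite loop_end.
Qed.

Definition some_partition (e : {posnum R}) (f : loop R x) : seq R :=
  projT1 (cid (strong_partition_exists (@loop_cont _ _ _ f) (gt0 e))).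

Lemma some_partitionP (e : {posnum R}) (f : loop R x) :
  strong_partition e%:num f 0 1 (some_partition e f).
Proof. by rewrite /some_partition; case: cid. Qed.

Definition strong_loop (e : {posnum R}) (f : loop R x) : eps_loop e%:num x :=
  EpsLoop (strong_loop_proof (some_partitionP e f)).

(* The class of an arbitrary strong chain along an arbitrary representative;
   by [h_eps_class] neither choice matters. *)
Definition h_eps (e : {posnum R}) (g : pi1 R x) : pi_eps e%:num x :=
  eps_class (strong_loop e (repr g)).

Lemma h_eps_class (e : {posnum R}) (f : loop R x) (c : eps_loop e%:num x) :
  strong_chain e%:num f 0 1 c -> h_eps e (pi1_class f) = eps_class c.
Proof.
move=> [s hs cE]; apply/eps_classP; rewrite cE.
pose f' := repr (pi1_class f); have hs' := some_partitionP e f'.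
have ff' : path_homotopic f' f by apply/pi1_classP; rewrite /pi1_class reprK.
have [v [v1 v2 v3]] := strong_chain_homotopic ff' (gt0 e).
apply: eps_homotopic_trans (strong_chain_unique (@loop_cont _ _ _ _) (gt0 e) hs' v1) _.
apply: eps_homotopic_trans v3 _.
exact: strong_chain_unique (@loop_cont _ _ _ _) (gt0 e) v2 hs.
Qed.

Lemma h_epsM (e : {posnum R}) (g h : pi1 R x) :
  h_eps e (g * h)%g = (h_eps e g * h_eps e h)%g.
Proof.
have [f ->] := pi1_surj g; have [k ->] := pi1_surj h; rewrite -pi1_classM.
have [s hs] := strong_partition_exists (@loop_cont _ _ _ f) (gt0 e).
have [t ht] := strong_partition_exists (@loop_cont _ _ _ k) (gt0 e).
rewrite (h_eps_class (f := f) (c := EpsLoop (strong_loop_proof hs))); last by exists s.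
rewrite (h_eps_class (f := k) (c := EpsLoop (strong_loop_proof ht))); last by exists t.
rewrite -eps_classM; apply: h_eps_class.
have fk : f 1 = k 0 by rewrite loop_start loop_end.
by have [v hv vE] := strong_partition_cat fk hs ht; exists v => //; exact: esym.
Qed.

Lemma h_eps1 (e : {posnum R}) : h_eps e 1%g = 1%g.
Proof.
apply: (mulgI (h_eps e 1%g)).
by rewrite -h_epsM !mulg1.
Qed.

Definition K_eps (e : {posnum R}) : set (pi1 R x) := [set g | h_eps e g = 1%g].

Definition pi_cl : set (pi1 R x) := \bigcap_(e in [set: {posnum R}]) K_eps e.

Lemma pi_cl_normal : normal_subgroup pi_cl.
Proof.
split=> [e _|g h hg hh e _|g hg e _|g h hg e _]; rewrite /K_eps /=.
- exact: h_eps1.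
- by rewrite h_epsM (hg e I) (hh e I) mulg1.
- by apply: (mulgI (h_eps e g)); rewrite -h_epsM mulgV h_eps1 (hg e I) mulg1.
- by rewrite /conjg !h_epsM (hg e I) mul1g -h_epsM mulVg h_eps1.
Qed.

Definition pi1_bar : groupType := quotient_group pi_cl_normal.

Fact eps_loop_le_proof (d e : R) (de : d < e) (c : eps_loop d x) :
  is_eps_loop e x c.
Proof.
rewrite /is_eps_loop (eps_chain_le (ltW de) (eps_loop_chain c)).
by rewrite eps_loop_head eps_loop_last eqxx.
Qed.

Definition eps_loop_le (d e : R) (de : d < e) (c : eps_loop d x) : eps_loop e x :=
  EpsLoop (eps_loop_le_proof de c).

Definition Phi (d e : R) (de : d < e) (g : pi_eps d x) : pi_eps e x :=
  eps_class (eps_loop_le de (repr g)).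

Lemma Phi_class (d e : R) (de : d < e) (c : eps_loop d x) :
  Phi de (eps_class c) = eps_class (eps_loop_le de c).
Proof. exact/eps_classP/(eps_homotopic_le (ltW de))/eps_class_repr. Qed.

Lemma PhiM (d e : R) (de : d < e) (g h : pi_eps d x) :
  Phi de (g * h)%g = (Phi de g * Phi de h)%g.
Proof.
have [b ->] := eps_class_surj g; have [c ->] := eps_class_surj h.
rewrite -eps_classM !Phi_class -eps_classM; congr eps_class.
exact: val_inj.
Qed.

Lemma Phi1 (d e : R) (de : d < e) : Phi de 1%g = 1%g.
Proof. by apply: (mulgI (Phi de 1%g)); rewrite -PhiM !mulg1. Qed.

Lemma PhiV (d e : R) (de : d < e) (g : pi_eps d x) : Phi de g^-1%g = (Phi de g)^-1%g.
Proof. by apply: (mulgI (Phi de g)); rewrite -PhiM !mulgV Phi1. Qed.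

Definition compatible (u : forall e : {posnum R}, pi_eps e%:num x) : Prop :=
  forall (d e : {posnum R}) (de : d%:num < e%:num), Phi de (u d) = u e.

Record Delta := MkDelta {
  Delta_fun :> forall e : {posnum R}, pi_eps e%:num x;
  DeltaP : compatible Delta_fun }.
HB.instance Definition _ := gen_eqMixin Delta.
HB.instance Definition _ := gen_choiceMixin Delta.

Lemma Delta_ext (u v : Delta) : (forall e, u e = v e) -> u = v.
Proof.
case: u => u hu; case: v => v hv /= uv; have E : u = v by apply: functional_extensionality_dep.
by subst v; congr MkDelta; exact: Prop_irrelevance.
Qed.

Local Fact Delta1_proof : compatible (fun=> 1%g).
Proof. by move=> d e de; rewrite Phi1. Qed.
Local Fact DeltaM_proof (u v : Delta) : compatible (fun e => u e * v e)%g.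
Proof. by move=> d e de; rewrite PhiM !DeltaP. Qed.
Local Fact DeltaV_proof (u : Delta) : compatible (fun e => (u e)^-1)%g.
Proof. by move=> d e de; rewrite PhiV DeltaP. Qed.

Definition Delta_one := MkDelta Delta1_proof.
Definition Delta_mul u v := MkDelta (DeltaM_proof u v).
Definition Delta_inv u := MkDelta (DeltaV_proof u).

Local Lemma Delta_mulA : associative Delta_mul.
Proof. by move=> u v w; apply: Delta_ext => e /=; rewrite mulgA. Qed.
Local Lemma Delta_mul1 : left_id Delta_one Delta_mul.
Proof. by move=> u; apply: Delta_ext => e /=; rewrite mul1g. Qed.
Local Lemma Delta_1mul : right_id Delta_one Delta_mul.
Proof. by move=> u; apply: Delta_ext => e /=; rewrite mulg1. Qed.
Local Lemma Delta_mulV : left_inverse Delta_one Delta_inv Delta_mul.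
Proof. by move=> u; apply: Delta_ext => e /=; rewrite mulVg. Qed.
Local Lemma Delta_Vmul : right_inverse Delta_one Delta_inv Delta_mul.
Proof. by move=> u; apply: Delta_ext => e /=; rewrite mulgV. Qed.

HB.instance Definition _ :=
  isGroup.Build Delta Delta_mulA Delta_mul1 Delta_1mul Delta_mulV Delta_Vmul.

Definition Cr : set R := [set e | 0 < e /\
  exists c : seq X, [/\ is_eps_loop e x c, ~ eps_null e x c
    & forall d, e < d -> eps_null d x c]].

End Projections.
Arguments K_eps {R X} x e.
Arguments pi_cl {R X} x.
Arguments pi1_bar {R X} x.
Arguments Delta {R X} x.
Arguments Cr {R X} x.

Section Covers.
Variables (E X : topologicalType).

Definition homeomorphism_between (A : set E) (B : set X) (p : E -> X) : Prop :=
  [/\ set_bij A B p, {within A, continuous p}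
    & exists2 q : X -> E, {within B, continuous q} & forall y, A y -> q (p y) = y].

Definition evenly_covered (p : E -> X) (U : set X) : Prop :=
  exists sheets : set (set E),
    [/\ p @^-1` U = \bigcup_(V in sheets) V, trivIset sheets id
      & forall V, sheets V -> open V /\ homeomorphism_between V U p].

Definition covering_map (p : E -> X) : Prop :=
  [/\ continuous p, forall z, exists y, p y = z
    & forall z, exists U : set X, [/\ open U, U z & evenly_covered p U]].

Definition is_cover (p : E -> X) : Prop :=
  connected [set: E] /\ covering_map p.

End Covers.

Definition simply_connected (R : realType) (E : topologicalType) : Prop :=
  (forall y z : E, exists f : R -> E, is_path f y z) /\
  (forall (y : E) (g : pi1 R y), g = 1%g).

Definition has_simply_connected_cover (R : realType) (X : topologicalType) : Prop :=
  exists (E : topologicalType) (p : E -> X), is_cover p /\ simply_connected R E.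

(* Main.v *)
Require Import Defs.
From mathcomp Require Import all_boot all_order all_algebra generic_quotient.
From mathcomp Require Import ring lra zify.
From mathcomp Require Import interval_inference boolp.
From mathcomp Require Import classical_sets functions cardinality reals ereal.
From mathcomp Require Import topology normedtype numfun.
From HB Require Import structures.

(** Chains and paths are compared through geodesics: a chain becomes the
    polygon obtained by joining consecutive points by geodesics, and a path
    becomes a strong chain along it. A strong chain along the polygon of a
    chain gives the chain back, so every [h_eps] is surjective. Everything
    turns on the scales at which it is also injective.

    Suppose that X has a simply connected cover. By compactness there is l > 0
    such that every ball of radius l lies in an evenly covered set. A loop in
    such a ball lifts to a loop of the cover, contracts there, and so is null
    in X ([covered_loops_null]). When 2e <= l, a basic move changes the
    polygon of an e-chain by a triangle lying in a ball of radius l, which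
    leaves its homotopy class unchanged ([polygon_homotopic]); and the polygon
    of a strong chain along f is homotopic to f, piece by piece. So the
    e-chain class of a loop determines its class in the fundamental group
    ([h_eps_inj]): the kernels K_e are trivial for small e, and there is no
    critical value below l/2.

    In every compact geodesic space, critical values that stay above some e0 >
    0 are finitely many ([Cr_finite_above]). Let e < d be close, say d < e +
    e0/2. Subdividing the steps of d-chains at midpoints turns a
    d-null-homotopy into an e-null-homotopy as soon as every triangle with
    sides < d is close to a triangle with sides < e ([eps_null_shrink]). Up to
    a small error, a triangle is a triple of points of a finite net, so a
    scale e only matters through the finite set of triples realized by
    triangles with sides < e, and two close critical values cannot realize the
    same triples.

    Conversely let e be smaller than every critical value. The supremum of the
    scales at which a chain is not null would be critical, so an e-null d-loop
    is d-null for all d < e ([eps_null_no_critical]). Thus all K_d with d <= e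
    coincide with [pi_cl], which is trivial, and [h_eps] is injective at e.
    The cover is the space of e-chains from x up to e-homotopy, mapped to X by
    the end of the chain. Adding one point to a chain is the local inverse of
    this map, and it makes lifting combinatorial: the end of a lifted path is
    its start extended by a strong chain. So a loop f of the cover lies over a
    loop of X with e-null strong chains, which is null in X because K_e = 1; a
    null-homotopy of it lifts to one of f ([square_lift]).

    Finally, when [h_eps] is bijective at all small scales, the inverse system
    of the groups of chains is constant there, so its limit is the fundamental
    group. *)

Set Implicit Arguments.
Unset Strict Implicit.
Unset Printing Implicit Defensive.

Import Order.TTheory GRing.Theory Num.Theory.
Import numFieldNormedType.Exports.

Local Open Scope classical_set_scope.
Local Open Scope ring_scope.
Local Open Scope quotient_scope.

(** * Homotopy algebra of paths *)

Section PathAlgebra.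
Variables (R : realType) (T : topologicalType).
Implicit Types (f g h : R -> T) (a b c d : T).

Lemma path_homotopic_refl f a b : is_path f a b -> path_homotopic f f.
Proof. by move=> [cf _ _]; exact: path_homotopic_eq. Qed.

Lemma path_homotopic_catA f g h a b c d :
  is_path f a b -> is_path g b c -> is_path h c d ->
  path_homotopic (path_cat f (path_cat g h)) (path_cat (path_cat f g) h).
Proof.
move=> pf pg ph; have [cc _ _] := path_catP (path_catP pf pg) ph.
by case: pf pg ph => _ _ f1 [_ g0 g1] [_ h0 _]; apply: path_catA;
  rewrite ?f1 ?g0 ?g1 ?h0.
Qed.

Lemma path_homotopic_1cat f a b :
  is_path f a b -> path_homotopic (path_cat (fun=> a) f) f.
Proof. by move=> [cf f0 _]; exact: path_cat1. Qed.

Lemma path_homotopic_cat1 f a b :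
  is_path f a b -> path_homotopic (path_cat f (fun=> b)) f.
Proof. by move=> [cf _ f1]; exact: path_1cat. Qed.

Lemma path_homotopic_catV f a b :
  is_path f a b -> path_homotopic (path_cat f (path_rev f)) (fun=> a).
Proof. by move=> [cf f0 _]; exact: path_cat_rev. Qed.

Lemma path_homotopic_Vcat f a b :
  is_path f a b -> path_homotopic (path_cat (path_rev f) f) (fun=> b).
Proof.
move=> pf; have pr := path_revP pf; have := path_homotopic_catV pr.
by rewrite {2}/path_rev (_ : (fun t => path_rev f (1 - t)) = f) //;
  apply/funext => t; rewrite /path_rev subKr.
Qed.

Lemma path_homotopic_catl f f' g a b c : is_path f a b -> is_path g b c ->
  path_homotopic f f' -> path_homotopic (path_cat f g) (path_cat f' g).
Proof.
move=> pf pg ff'; apply: path_homotopic_cat => //; last exact: path_homotopic_refl pg.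
by case: pf pg => _ _ -> [_ -> _].
Qed.

Lemma path_homotopic_catr f g g' a b c : is_path f a b -> is_path g b c ->
  path_homotopic g g' -> path_homotopic (path_cat f g) (path_cat f g').
Proof.
move=> pf pg gg'; apply: path_homotopic_cat => //; first by case: pf pg => _ _ -> [_ -> _].
exact: path_homotopic_refl pf.
Qed.

Lemma path_homotopic_cancel f g a b : is_path f a b -> is_path g a b ->
  path_homotopic (path_cat f (path_rev g)) (fun=> a) -> path_homotopic f g.
Proof.
move=> pf pg fg; have pr := path_revP pg.
apply: (path_homotopic_trans (path_homotopic_sym (path_homotopic_cat1 pf))).
apply: (path_homotopic_trans (g := path_cat f (path_cat (path_rev g) g))).
  apply: (path_homotopic_catr pf (is_path_cst R b)).
  exact/path_homotopic_sym/path_homotopic_Vcat/pg.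
apply: (path_homotopic_trans (path_homotopic_catA pf pr pg)).
apply: path_homotopic_trans (path_homotopic_1cat pg).
exact: path_homotopic_catl (path_catP pf pr) pg fg.
Qed.

(** Change of base point: a loop is null as soon as its conjugate by some path
    is, because it can be recovered by conjugating back. *)
Lemma loop_homotopic_conj f g a b : is_path g a b -> is_path f b b ->
  path_homotopic (path_cat (path_cat g f) (path_rev g)) (fun=> a) ->
  path_homotopic f (fun=> b).
Proof.
move=> pg pf hfg; have pr := path_revP pg; have pgf := path_catP pg pf.
have {hfg} gf := path_homotopic_cancel pgf pg hfg.
apply: (path_homotopic_trans (path_homotopic_sym (path_homotopic_1cat pf))).
apply: (path_homotopic_trans (g := path_cat (path_cat (path_rev g) g) f)).
  apply: (path_homotopic_catl (is_path_cst R b) pf).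
  exact/path_homotopic_sym/path_homotopic_Vcat/pg.
apply: (path_homotopic_trans (path_homotopic_sym (path_homotopic_catA pr pg pf))).
apply: path_homotopic_trans (path_homotopic_Vcat pg).
exact: path_homotopic_catr pr pgf gf.
Qed.

Definition subpath f (s t : R) : R -> T := fun r => f (s + r * (t - s)).

Lemma subpathP f s t : 0 <= s -> s <= t -> t <= 1 ->
  {within `[0, 1], continuous f} -> is_path (subpath f s t) (f s) (f t).
Proof.
move=> s0 st t1 cf; split; last 2 first.
- by rewrite /subpath mul0r addr0.
- by rewrite /subpath mul1r addrC subrK.
rewrite (_ : subpath f s t = f \o (fun r => s + r * (t - s))) //.
apply: within_comp1 => //.
  by move=> r /=; rewrite !in_itv /= => /andP[r0 r1]; nra.
move=> r; apply: cvgD; first exact: cvg_cst.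
by apply: cvgM; [exact: cvg_id|exact: cvg_cst].
Qed.

(** Both sides are reparametrizations of f with the same ends, by an affine and
    by a piecewise affine map, so the straight homotopy between the two maps
    works. *)
Lemma subpath_cat f s t u : 0 <= s -> s <= t -> t <= u -> u <= 1 ->
  {within `[0, 1], continuous f} ->
  path_homotopic (subpath f s u) (path_cat (subpath f s t) (subpath f t u)).
Proof.
move=> s0 st tu u1 cf.
pose p (r : R) : R := (u - s) * r + s.
pose q (r : R) : R := (Num.min 1 (2 * r + 0)) * (t - s) + s + (Num.max 0 (2 * r + -1)) * (u - t).
have cp : continuous p by exact: continuous_affine.
have cmin : continuous (fun r : R => Num.min 1 (2 * r + 0)).
  by apply: continuous_minf; [move=> ?; exact: cvg_cst|exact: continuous_affine].
have cmax : continuous (fun r : R => Num.max 0 (2 * r + -1)).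
  by apply: continuous_maxf; [move=> ?; exact: cvg_cst|exact: continuous_affine].
have cq : continuous q.
  move=> r; apply: cvgD; first apply: cvgD; last 2 first.
  - exact: cvg_cst.
  - by apply: cvgM; [exact: cmax|exact: cvg_cst].
  - by apply: cvgM; [exact: cmin|exact: cvg_cst].
have ip r : 0 <= r <= 1 -> 0 <= p r <= 1 by rewrite /p => /andP[? ?]; nra.
have iq r : 0 <= r <= 1 -> 0 <= q r <= 1.
  move=> /andP[r0 r1]; rewrite /q /Num.min /Num.max.
  by case: ifP => ?; case: ifP => ?; nra.
have p0 : p 0 = q 0 by rewrite /p /q /Num.min /Num.max; case: ifP => ?; case: ifP => ?; nra.
have p1 : p 1 = q 1 by rewrite /p /q /Num.min /Num.max; case: ifP => ?; case: ifP => ?; nra.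
have h := path_reparam cf cp cq ip iq p0 p1.
have [cs _ _] := subpathP s0 (le_trans st tu) u1 cf.
apply: (path_homotopic_trans (g := f \o p)).
  by apply: path_homotopic_eq => // r _; rewrite /subpath /p /=; congr f; ring.
apply: (path_homotopic_trans h); apply: path_homotopic_eq.
  by apply: (@within_comp1 R T R `[0, 1] q f).
move=> r /andP[r0 r1]; rewrite /path_cat /subpath /q /Num.min /Num.max /=.
by case: ifP => h1; case: ifP => h2; case: ifP => h3; congr f; nra.
Qed.

End PathAlgebra.

Lemma path_homotopic_comp (R : realType) (S T : topologicalType) (p : S -> T)
    (f g : R -> S) : continuous p ->
  path_homotopic f g -> path_homotopic (p \o f) (p \o g).
Proof.
move=> cp [H [cH H0 H1]]; exists (p \o H); split.
- by move=> u; exact: (cvg_comp _ _ (cH u) (cp (H u))).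
- by move=> t /H0[/= -> ->].
- by move=> s /H1[/= -> ->].
Qed.

(** * Chain homotopies and subdivision *)

Section ChainMoves.
Variables (R : realType) (X : metricType R).
Implicit Types (e d : R) (x y z : X) (b c : seq X).

(** A basic move is one of two local moves, repeating a point or going round a
    small triangle, performed after a common initial segment.  Hence an
    invariant of chain homotopy only has to be checked on these two moves and
    on adding a common first step. *)
Lemma eps_homotopic_ind e (Q : seq X -> seq X -> Prop) :
  (forall b, Q b b) -> (forall b c, Q b c -> Q c b) ->
  (forall a b c, Q a b -> Q b c -> Q a c) ->
  (forall x t, eps_near e x x -> eps_chain e (x :: t) -> Q (x :: t) [:: x, x & t]) ->
  (forall x y z t, eps_near e x y -> eps_near e x z -> eps_near e z y ->
     eps_chain e (y :: t) -> Q [:: x, y & t] [:: x, z, y & t]) ->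
  (forall x y s t, eps_near e x y -> eps_chain e (y :: s) -> eps_chain e (y :: t) ->
     Q (y :: s) (y :: t) -> Q [:: x, y & s] [:: x, y & t]) ->
  forall b c, eps_homotopic e b c -> Q b c.
Proof.
move=> Qrefl Qsym Qtrans Qdup Qtri Qcons.
suff h b c : insertion e b c -> Q b c.
  move=> b c; elim=> [b' c' []|//|? ? _ /Qsym //|? ? ? _ + _]; last exact: Qtrans.
    exact: h.
  by move=> /h /Qsym.
move=> [s [z [t [-> -> + +]]]] {b c}.
elim: s => [|x s IHs] /=.
  case: t => [//|y t] h1; rewrite eps_chain_cons /= => /andP[zy _] /(_ y)[yz _].
  by rewrite -yz in zy *; exact: Qdup.
case: s IHs => [|y s] IHs /=; last first.
  rewrite !eps_chain_cons /= => /andP[xy h1] /andP[_ h2] h3.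
  by apply: Qcons => //; apply: IHs => // w; have [_] := h3 w.
case: t {IHs} => [|y t].
  rewrite !eps_chain_cons /= => _ /andP[xz _] /(_ x)[_ zx].
  by rewrite -zx in xz *; exact: Qdup.
rewrite !eps_chain_cons /= => /andP[xy yt] /and3P[xz zy _] _.
exact: Qtri.
Qed.

Lemma eps_homotopic_ends e b c : eps_homotopic e b c ->
  forall w, head w b = head w c /\ last w b = last w c.
Proof.
elim=> [b' c' [] [s [z [t [_ _ _ _ h]]]] w|//|b' c' _ h w|a b' c' _ h _ h' w].
- exact: h.
- by have [-> ->] := h w.
- by have [-> ->] := h w.
- by have [-> ->] := h w.
Qed.

Lemma eps_homotopic_dup e x t : eps_near e x x -> eps_chain e (x :: t) ->
  eps_homotopic e (x :: t) [:: x, x & t].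
Proof.
move=> xx xt; apply: insertion_homotopic; exists [:: ], x, (x :: t); split=> //.
by rewrite eps_chain_cons /= xx.
Qed.

Lemma eps_homotopic_tri e x y z t :
  eps_near e x y -> eps_near e x z -> eps_near e z y -> eps_chain e (y :: t) ->
  eps_homotopic e [:: x, y & t] [:: x, z, y & t].
Proof.
move=> xy xz zy yt; apply: (@insert_homotopic _ _ e [:: x] z (y :: t)) => //.
  by rewrite /= eps_chain_cons /= xy.
by rewrite /= eps_chain_cons /= xz zy.
Qed.

Lemma eps_homotopic_cons e x y b c :
  eps_homotopic e (y :: b) (y :: c) -> eps_near e x y ->
  eps_homotopic e [:: x, y & b] [:: x, y & c].
Proof.
move=> h xy; apply: (eps_homotopic_catl (k := [:: x; y]) h) => //.
by rewrite eps_chain_cons /= xy.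
Qed.

(** The rungs of the ladder are passed one at a time, each by two triangles.
    The top chain is completed by the last point of the bottom one, and the
    bottom chain by the first point of the top one, so neither pair of ends
    needs to agree. *)
Lemma eps_homotopic_ladder (T : Type) e (f g : T -> X) a u :
  path (fun i j => [&& eps_near e (f i) (f j), eps_near e (g i) (g j)
    & eps_near e (f i) (g j)]) a u ->
  all (fun i => eps_near e (f i) (g i)) (a :: u) ->
  eps_homotopic e (rcons (map f (a :: u)) (g (last a u))) (f a :: map g (a :: u)).
Proof.
elim: u a => [|y u IHu] a; first by move=> _ _; exact: eps_homotopic_refl.
move=> /= /andP[/and3P[fay gay fga] yu] /andP[fa hyu].
have hg : eps_chain e (g y :: map g u).
  rewrite eps_chain_cons path_map; apply: sub_path yu => i j.
  by case/and3P.
have /= fgy := IHu y yu hyu; move: (hyu) => /= /andP[fy _].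
apply: (eps_homotopic_trans (eps_homotopic_cons fgy fay)).
apply: (@eps_homotopic_trans _ _ e _ [:: f a, g y & map g u]).
  by apply: eps_homotopic_sym; exact: eps_homotopic_tri.
exact: eps_homotopic_tri.
Qed.

End ChainMoves.

Section Subdivision.
Variables (R : realType) (X : metricType R).
Variable mid : X -> X -> X.
Implicit Types (e d : R) (x y z : X) (b c s t : seq X).

Fixpoint subdivide_from x s : seq X :=
  if s is y :: s' then [:: mid x y, y & subdivide_from y s'] else [::].

Definition subdivide_chain c : seq X :=
  if c is x :: s then x :: subdivide_from x s else [::].

Variables e d : R.
Hypothesis ed : e <= d.
Hypothesis midP : forall x y, mdist x y < d ->
  mdist x (mid x y) < 3 / 4 * e /\ mdist (mid x y) y < 3 / 4 * e.
Hypothesis shrink : forall x y z, mdist x y < d -> mdist x z < d -> mdist z y < d ->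
  exists x' y' z', [/\ mdist x x' < e / 4, mdist y y' < e / 4 & mdist z z' < e / 4] /\
    [/\ mdist x' y' < e, mdist x' z' < e & mdist z' y' < e].

Local Lemma subdivide_near x y : mdist x y < d ->
  eps_near e x (mid x y) /\ eps_near e (mid x y) y.
Proof.
move=> xy; have [h1 h2] := midP xy; rewrite /eps_near.
have := le_lt_trans (mdist_ge0 _ _) h1.
by move=> e0; split; lra.
Qed.

Lemma subdivide_chainP c : eps_chain d c -> eps_chain e (subdivide_chain c).
Proof.
case: c => // x s; rewrite !eps_chain_cons.
elim: s x => //= y s IHs x /andP[xy ys].
by have [-> ->] := subdivide_near xy; exact: IHs.
Qed.

Lemma subdivide_homotopic c : eps_chain e c -> eps_homotopic e c (subdivide_chain c).
Proof.
case: c => // x s.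
rewrite eps_chain_cons; elim: s x => [|y s IHs] x /=; first by move=> _; exact: eps_homotopic_refl.
move=> /andP[xy ys].
have xyd : mdist x y < d by exact: lt_le_trans xy ed.
have [h1 h2] := subdivide_near xyd.
apply: (eps_homotopic_trans (eps_homotopic_cons (IHs _ ys) xy)).
apply: eps_homotopic_tri => //.
apply: (subdivide_chainP (c := y :: s)).
by apply: eps_chain_le ed _; rewrite eps_chain_cons.
Qed.

(** The rectangle x, y, y', x' is cut at the midpoint of x and y into triangles
    with sides < e, since x and y themselves may be too far apart. *)
Local Lemma midpoint_slide x y x' y' t : mdist x y < d ->
  mdist x x' < e / 4 -> mdist y y' < e / 4 -> mdist x' y' < e ->
  eps_chain e (y :: t) ->
  eps_homotopic e [:: x, mid x y, y & t] [:: x, x', y', y & t].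
Proof.
move=> xy xx yy xy' yt; have [h1 h2] := midP xy.
have e0 : 0 < e by have := le_lt_trans (mdist_ge0 _ _) h1; lra.
set m := mid x y in h1 h2 *.
have nxx : eps_near e x x' by rewrite /eps_near; lra.
have nyy : eps_near e y' y by rewrite eps_near_sym /eps_near; lra.
have nxm : eps_near e x m by rewrite /eps_near; lra.
have nmy : eps_near e m y by rewrite /eps_near; lra.
have nxm' : eps_near e x' m.
  by rewrite /eps_near; have := metric_triangle x' x m; rewrite (metric_sym x' x); lra.
have nmy' : eps_near e m y'.
  by rewrite /eps_near; have := metric_triangle m y y'; lra.
have nxy : eps_near e x' y' by [].
apply: (@eps_homotopic_trans _ _ e _ [:: x, x', m, y & t]).
  by apply: eps_homotopic_tri => //; rewrite eps_chain_cons /= nmy.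
apply: (@eps_homotopic_trans _ _ e _ [:: x, x', m, y', y & t]).
  by apply: eps_homotopic_cons => //; apply: eps_homotopic_cons => //; exact: eps_homotopic_tri.
apply: eps_homotopic_cons => //; apply: eps_homotopic_sym; apply: eps_homotopic_tri => //.
by rewrite eps_chain_cons /= nyy.
Qed.

(** The subdivided triangle is pushed, edge by edge, onto a nearby triangle with
    sides < e, which is contracted by one basic move. *)
Local Lemma subdivide_tri x y z t :
  mdist x y < d -> mdist x z < d -> mdist z y < d -> eps_chain e (y :: t) ->
  eps_homotopic e [:: x, mid x y, y & t] [:: x, mid x z, z, mid z y, y & t].
Proof.
move=> xy xz zy yt; have [x' [y' [z' [[xx yy zz] [xy' xz' zy']]]]] := shrink xy xz zy.
have e0 : 0 < e by have := le_lt_trans (mdist_ge0 _ _) xx; lra.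
have [h1 h2] := subdivide_near xy.
have [h3 h4] := subdivide_near xz; have [h5 h6] := subdivide_near zy.
have nxx : eps_near e x x' by rewrite /eps_near; lra.
have nyy : eps_near e y' y by rewrite eps_near_sym /eps_near; lra.
have nzz : eps_near e z' z by rewrite eps_near_sym /eps_near; lra.
have nzz' : eps_near e z z' by rewrite eps_near_sym.
have nzz2 : eps_near e z' z' by rewrite /eps_near mdistxx.
have ytc : eps_chain e [:: y', y & t] by rewrite eps_chain_cons /= nyy.
apply: (eps_homotopic_trans (midpoint_slide xy xx yy xy' yt)); apply: eps_homotopic_sym.
apply: (@eps_homotopic_trans _ _ e _ [:: x, mid x z, z, z', y', y & t]).
  by do 2 apply: eps_homotopic_cons => //; exact: midpoint_slide.
have nzy' : eps_near e z' y' by [].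
have ztc : eps_chain e [:: z', y', y & t] by rewrite eps_chain_cons /= nzy' nyy.
apply: (eps_homotopic_trans (midpoint_slide xz xx zz xz' (t := [:: z', y', y & t]) _)).
  by rewrite eps_chain_cons /= nzz' nzy' nyy.
apply: eps_homotopic_cons => //; apply: (@eps_homotopic_trans _ _ e _ [:: x', z', z', y', y & t]).
  apply: eps_homotopic_sym; apply: eps_homotopic_cons => //; exact: eps_homotopic_tri.
apply: (@eps_homotopic_trans _ _ e _ [:: x', z', y', y & t]); apply: eps_homotopic_sym.
  by apply: eps_homotopic_cons => //; exact: eps_homotopic_dup.
exact: eps_homotopic_tri.
Qed.

Lemma subdivide_chain_homotopic b c : eps_homotopic d b c ->
  eps_homotopic e (subdivide_chain b) (subdivide_chain c).
Proof.
move: b c; apply: (eps_homotopic_ind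
  (Q := fun b c => eps_homotopic e (subdivide_chain b) (subdivide_chain c))).
- by move=> ?; exact: eps_homotopic_refl.
- by move=> ? ?; exact: eps_homotopic_sym.
- by move=> ? ? ?; exact: eps_homotopic_trans.
- move=> x t xx xt /=; have [h1 h2] := subdivide_near xx.
  have e0 : 0 < e by exact: le_lt_trans (mdist_ge0 _ _) h1.
  have nxx : eps_near e x x by rewrite /eps_near mdistxx.
  have xte := subdivide_chainP xt.
  apply: (eps_homotopic_trans (eps_homotopic_dup nxx xte)).
  exact: eps_homotopic_tri.
- by move=> x y z t xy xz zy yt /=; apply: subdivide_tri => //; exact: (subdivide_chainP yt).
- move=> x y s t xy ys yt h /=; have [h1 h2] := subdivide_near xy.
  by do 2 apply: eps_homotopic_cons => //.
Qed.

(** Subdivision turns every basic move of a d-null-homotopy into an e-homotopy,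
    and it does not change the e-homotopy class of an e-chain. *)
Lemma eps_null_shrink x c : is_eps_loop e x c -> eps_null d x c -> eps_null e x c.
Proof.
move=> /and3P[ec _ _] dc.
exact: eps_homotopic_trans (subdivide_homotopic ec) (subdivide_chain_homotopic dc).
Qed.

End Subdivision.

Section CriticalValues.
Variables (R : realType) (X : metricType R) (x : X).
Implicit Types (e d : R) (b c : seq X).

(** A homotopy involves finitely many steps, all strictly shorter than e, so it
    survives when e is slightly decreased. *)
Lemma eps_homotopic_lower e b c : 0 < e -> eps_homotopic e b c ->
  exists d, [/\ 0 <= d, d < e & forall d', d < d' -> eps_homotopic d' b c].
Proof.
move=> e0.
have chain_lower k : eps_chain e k ->
    exists d, [/\ 0 <= d, d < e & forall d', d < d' -> eps_chain d' k].
  case: k => // y s; rewrite eps_chain_cons.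
  elim: s y => [|z s IHs] y /=; first by exists 0.
  move=> /andP[yz /IHs[d [d0 de h]]]; exists (Num.max d (mdist y z)).
  split; first by rewrite le_max d0.
    by rewrite gt_max de.
  by move=> d'; rewrite gt_max => /andP[dd yd]; rewrite eps_chain_cons /= [eps_near _ _ _]yd; exact: h.
have ins b' c' : insertion e b' c' ->
    exists d, [/\ 0 <= d, d < e & forall d', d < d' -> eps_homotopic d' b' c'].
  move=> [s [z [t [-> -> /chain_lower[d1 [d10 d1e h1]] /chain_lower[d2 [_ d2e h2]] h3]]]].
  exists (Num.max d1 d2); split; first by rewrite le_max d10.
    by rewrite gt_max d1e.
  move=> d'; rewrite gt_max => /andP[/h1 k1 /h2 k2].
  by apply: insertion_homotopic; exists s, z, t.
elim=> [b' c' []|b'|b' c' _ [d [d0 de h]]|a' b' c' _ [d1 [d10 d1e h1]] _ [d2 [_ d2e h2]]].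
- exact: ins.
- by move=> /ins[d [d0 de h]]; exists d; split=> // d' /h; exact: eps_homotopic_sym.
- by exists 0; split=> // d' _; exact: eps_homotopic_refl.
- by exists d; split=> // d' /h; exact: eps_homotopic_sym.
- exists (Num.max d1 d2); split; first by rewrite le_max d10.
    by rewrite gt_max d1e.
  by move=> d'; rewrite gt_max => /andP[/h1 k1 /h2 k2]; exact: eps_homotopic_trans k1 k2.
Qed.

(** If c is not d-null, take the supremum s of the scales at which it is not
    null.  By [eps_homotopic_lower] it cannot be s-null, so s is critical. *)
Lemma eps_null_no_critical d e c : 0 < d -> d <= e ->
  (forall r, d <= r -> r <= e -> ~ Cr x r) ->
  is_eps_loop d x c -> eps_null e x c -> eps_null d x c.
Proof.
move=> d0 de noCr lc ec; apply: contrapT => ndc.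
pose A := [set r : R | d <= r /\ ~ eps_null r x c].
have Ad : A d by split.
have Ae r : A r -> r <= e.
  move=> [_ nr]; rewrite leNgt; apply/negP => er; apply: nr.
  exact: eps_homotopic_le (ltW er) ec.
have hA : has_sup A by split; [exists d|exists e => r /Ae].
pose s := sup A.
have ds : d <= s by apply: ub_le_sup => //; exact: hA.2.
have se : s <= e by apply: ge_sup; [exists d|move=> r /Ae].
have s0 : 0 < s by exact: lt_le_trans ds.
have above r : s < r -> eps_null r x c.
  move=> sr; apply: contrapT => nr.
  have /(ub_le_sup hA.2) : A r by split=> //; apply: le_trans ds (ltW sr).
  by rewrite leNgt sr.
have [sc|nsc] := pselect (eps_null s x c); last first.
  apply: (noCr s) => //; split=> //; exists c; split=> //.
  case/and3P: lc => cc hc tc; apply/and3P; split=> //.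
  exact: eps_chain_le cc.
have [t [t0 ts ht]] := eps_homotopic_lower s0 sc.
have [r [Ar nr] tr] := sup_gt (ex_intro _ d Ad) ts.
by apply: nr; apply: ht.
Qed.

Lemma eps_null_large e c : (forall y z : X, mdist y z < e) ->
  is_eps_loop e x c -> eps_null e x c.
Proof.
move=> small; case: c => [//|y s]; rewrite /is_eps_loop /= => /and3P[_ /eqP -> /eqP].
clear y; elim: s => [|y s IHs] h; first exact: eps_homotopic_refl.
have yes b : eps_chain e (x :: b).
  by rewrite eps_chain_cons; elim: b x => //= z b IHb a; rewrite [eps_near _ _ _]small IHb.
case: s IHs h => [|z s] IHs /= h.
  by rewrite h; apply: eps_homotopic_sym; apply: eps_homotopic_dup => //; exact: small.
apply: eps_homotopic_trans (IHs h); apply: eps_homotopic_sym.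
apply: eps_homotopic_tri; try exact: small.
by have := yes (z :: s); rewrite !eps_chain_cons /= => /andP[].
Qed.

End CriticalValues.

(** * Geodesics, nets and finiteness of the critical values *)

Section GeodesicSpaces.
Variables (R : realType) (X : metricType R).
Implicit Types (x y z : X).

Lemma mdist_itv_chord (a b t : R) (f : R -> X) : a <= t -> t <= b ->
  ((mdist (f a) (f t) + mdist (f t) (f b))%:E <= curve_length a b f)%E.
Proof.
move=> at_ tb.
have ubd s : itv_partition a b s -> ((chord_sum f a s)%:E <= curve_length a b f)%E.
  by move=> hs; apply: ereal_sup_ubound; exists s.
have [ab|ab] := eqVneq a b.
  have -> : t = a by lra.
  have hs : itv_partition a b [::] by split=> //; exact/eqP.
  by have := ubd _ hs; rewrite /chord_sum big_nil -ab mdistxx addr0.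
have {}ab : a < b by lra.
have hs1 : itv_partition a b [:: b] by apply: itv_partition1.
have := ubd _ hs1; rewrite /chord_sum big_nat1 /= => h1.
have [->|ta] := eqVneq t a; first by rewrite mdistxx add0r.
have [->|tb'] := eqVneq t b; first by rewrite mdistxx addr0.
have hs : itv_partition a b [:: t; b].
  split=> //=; rewrite andbT; apply/andP; split; lra.
by have := ubd _ hs; rewrite /chord_sum big_nat_recl //= big_nat1.
Qed.

Hypothesis geodesicX : geodesic_space X.

Lemma geodesic_exists x y : exists g : R -> X, is_path g x y /\
  forall t, 0 <= t <= 1 -> mdist x (g t) + mdist (g t) y <= mdist x y.
Proof.
have [a [b [f [ab cf fa fb L]]]] := geodesicX x y.
exists (fun t => f (a + t * (b - a))); split; last first.
  move=> t /andP[t0 t1]; rewrite -lee_fin -L -fa -fb.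
  by apply: mdist_itv_chord; nra.
split; last 2 first.
- by rewrite mul0r addr0.
- by rewrite mul1r addrC subrK.
pose p (t : R) : R := a + t * (b - a).
apply: (@within_comp R R X `[0, 1]%classic `[a, b]%classic p f) => //.
  by move=> t /=; rewrite !in_itv /= /p => /andP[t0 t1]; nra.
move=> t; apply: cvgD; first exact: cvg_cst.
by apply: cvgM; [exact: cvg_id|exact: cvg_cst].
Qed.

(** A chosen geodesic, parametrized by the unit interval; it need not
    depend continuously on its ends. *)
Definition geo x y : R -> X := projT1 (cid (geodesic_exists x y)).

Lemma geoP x y : is_path (geo x y) x y.
Proof. by rewrite /geo; case: cid => g []. Qed.

Lemma geo_dist x y t : 0 <= t <= 1 ->
  mdist x (geo x y t) + mdist (geo x y t) y <= mdist x y.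
Proof. by rewrite /geo; case: cid => g [_] /= h /h. Qed.

Lemma mdist_continuous x : continuous (fun y => mdist x y : R).
Proof.
move=> y; apply/cvgrPdist_lt => e e0.
have := nbhsx_ballx y e e0; apply: filterS => z; rewrite ballEmdist /= => yz.
have := metric_triangle x y z; have := metric_triangle x z y.
by rewrite (metric_sym z y) ltr_norml; lra.
Qed.

Lemma midpoint_exists x y : exists m, mdist x m <= mdist x y / 2 /\ mdist m y <= mdist x y / 2.
Proof.
have [cg g0 g1] := geoP x y; pose g := geo x y.
have c : {within `[0, 1], continuous (fun t => mdist x (g t))}.
  move=> u; apply: cvg_comp; first exact: cg.
  exact: mdist_continuous.
have := IVT (v := mdist x y / 2) (@ler01 R) c.
have d0 := mdist_ge0 x y.
rewrite /= /g g0 g1 mdistxx /Num.min /Num.max.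
case.
  by case: ifP => ?; lra.
move=> t; rewrite in_itv /= => /geo_dist -/(_ x y) h1 h2; exists (geo x y t).
by lra.
Qed.

End GeodesicSpaces.

Section CompactNets.
Variables (R : realType) (X : metricType R).
Hypothesis compactX : compact [set: X].

(** The net is obtained from compactness as a covering along the filter of
    supersets of finite sequences. *)
Lemma finite_net (r : R) : 0 < r ->
  exists s : seq X, forall z, exists2 y, y \in s & mdist y z < r.
Proof.
(* Enlarging the net keeps a covered neighbourhood covered, so the net of
a single point works near that point. *)
move=> r0; pose up (s : seq X) := [set s' : seq X | {subset s <= s'}].
pose F := filter_from [set: seq X] up.
have FF : Filter F.
  apply: filter_from_filter; first by exists [::].
  move=> s t _ _; exists (s ++ t) => // u su.
  by split=> y ys; apply: su; rewrite mem_cat ys ?orbT.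
have := compactX; rewrite compact_near_coveringP => /(_ _ F
  (fun s z => exists2 y, y \in s & mdist y z < r) FF) [].
  move=> z _; exists (ball z r, up [:: z]) => /=.
    by split; [exact: nbhsx_ballx|exists [:: z]].
  move=> [z' s] /= []; rewrite ballEmdist /= => zz' zs.
  by exists z => //; apply: zs; rewrite inE.
by move=> s _ /(_ s) h; exists s => z; apply: h.
Qed.

Lemma mdist_bounded : exists D : R, forall y z : X, mdist y z < D.
Proof.
have [s hs] := finite_net (@ltr01 R).
pose M := \sum_(y <- s) \sum_(z <- s) mdist y z.
exists (M + 2) => y z; have [a as_ ay] := hs y; have [b bs bz] := hs z.
have ab : mdist a b <= M.
  rewrite /M (big_rem a) //= (big_rem b) //= -addrA lerDl addr_ge0 //.
    by apply: sumr_ge0 => ? _; exact: mdist_ge0.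
  by apply: sumr_ge0 => ? _; apply: sumr_ge0 => ? _; exact: mdist_ge0.
have := metric_triangle y a z; have := metric_triangle a b z.
by rewrite (metric_sym y a); lra.
Qed.

End CompactNets.

Section FinitelyManyCritical.
Variables (R : realType) (X : metricType R) (x : X).
Hypotheses (compactX : compact [set: X]) (geodesicX : geodesic_space X).

Lemma finite_set_inj (S : Type) (F : finType) (A : set S) (f : S -> F) :
  (forall u v, A u -> A v -> f u = f v -> u = v) -> finite_set A.
Proof.
move=> fi; have /eq_finite_set <- : (f @` A #= A)%card.
  by apply: inj_card_eq => u v /set_mem Au /set_mem Av; exact: fi.
exact: finite_finset.
Qed.

(** A critical value e is determined by two finite data: the triples of net
    points close to a triangle with sides < e, and the integer part of
    2e/e0.  For e < d with the same data, [eps_null_shrink] applies, so every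
    e-loop that is d-null is e-null, against the criticality of e. *)
Lemma Cr_finite_above (e0 : R) : 0 < e0 ->
  (forall e, Cr x e -> e0 <= e) -> finite_set (Cr x).
Proof.
move=> e00 low.
(* With net points within r of each vertex, two triangles having the same
net triple are within 2r = e0 / 8 <= e / 8 of each other, which is
below the e / 4 that subdivision tolerates. *)
pose r := e0 / 16; have r0 : 0 < r by rewrite /r; lra.
have [s hs] := finite_net compactX r0; have [D hD] := mdist_bounded compactX.
have CrD e : Cr x e -> e < D.
  move=> [_ [c [lc nc _]]]; rewrite ltNge; apply/negP => De; apply: nc.
  by apply: eps_null_large => // y z; exact: lt_le_trans De.
pose pt (i : 'I_(size s)) := nth x s i.
have netP z : exists i, mdist (pt i) z < r.
  have [y ys yz] := hs z; have ys' : (index y s < size s)%N by rewrite index_mem.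
  by exists (Ordinal ys'); rewrite /pt /= nth_index.
pose tri (e : R) (u : 'I_(size s) * 'I_(size s) * 'I_(size s)) : bool :=
  `[< exists x' y' z', [/\ mdist (pt u.1.1) x' < r, mdist (pt u.1.2) y' < r & mdist (pt u.2) z' < r] /\
    [/\ mdist x' y' < e, mdist x' z' < e & mdist z' y' < e] >].
pose M := Num.truncn (D / (e0 / 2)).
pose f (e : R) := ([ffun u => tri e u], inord (Num.truncn (e / (e0 / 2))) : 'I_M.+1).
suff key e d : Cr x e -> Cr x d -> f e = f d -> e < d -> False.
  apply: (@finite_set_inj _ _ _ f) => e d Ce Cd fed.
  by have [/(key _ _ Ce Cd fed)|/(key _ _ Cd Ce (esym fed))|] := ltgtP e d.
move=> Ce Cd [/ffunP tE kE] ed.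
have e20 : 0 < e0 / 2 by lra.
have trunc a : Cr x a -> (Num.truncn (a / (e0 / 2)) < M.+1)%N.
  move=> Ca; rewrite ltnS; apply: le_truncn.
  by rewrite ler_pM2r ?invr_gt0 //; exact/ltW/CrD.
have {}kE : Num.truncn (e / (e0 / 2)) = Num.truncn (d / (e0 / 2)).
  by move/(congr1 (@nat_of_ord _)): kE; rewrite !inordK ?trunc.
(* Since e0 <= e, this gives d < 3e/2, so that half a step of a d-chain is
shorter than 3e/4. *)
have de : d < e + e0 / 2.
  have k1 := truncnS_gt (d / (e0 / 2)).
  have := truncn_le (e / (e0 / 2)); rewrite divr_ge0 ?(ltW e20) ?(le_trans _ (low _ Ce)) ?(ltW e00) //.
  move: k1; rewrite -kE -[X in _ < X -> _]natr1 ltr_pdivrMr // mulrDl mul1r ler_pdivlMr //; lra.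
have e0e := low _ Ce.
move: Ce Cd => [_ [c [lc nc hc]]] _; apply: nc.
pose mid y z := projT1 (cid (midpoint_exists geodesicX y z)).
have midE y z : mdist y (mid y z) <= mdist y z / 2 /\ mdist (mid y z) z <= mdist y z / 2.
  by rewrite /mid; case: cid.
apply: (@eps_null_shrink R X mid e d (ltW ed)) => //; last exact: hc.
- by move=> y z yz; have [] := midE y z; lra.
- move=> y z w yz yw wz.
  have [i iy] := netP y; have [j jz] := netP z; have [k kw] := netP w.
  have : tri d (i, j, k) by apply/asboolP; exists y, z, w.
  have := tE (i, j, k); rewrite !ffunE => <- /asboolP[y' [z' [w' [[/= h1 h2 h3] h]]]].
  exists y', z', w'; split=> //.
  have t1 := metric_triangle y (pt i) y'; have t2 := metric_triangle z (pt j) z'.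
  have t3 := metric_triangle w (pt k) w'.
  by move: t1 t2 t3; rewrite !(metric_sym _ (pt _)) /r in iy jz kw h1 h2 h3 *; split; lra.
Qed.

End FinitelyManyCritical.

(** * Geodesic polygons along chains *)

Section GeodesicPolygons.
Variables (R : realType) (X : metricType R).
Hypothesis geodesicX : geodesic_space X.
Implicit Types (x y z : X) (e l : R) (f g : R -> X) (s : seq X).

Notation geo := (geo geodesicX).

Fixpoint polygon x s : R -> X :=
  if s is y :: s' then path_cat (geo x y) (polygon y s') else fun=> x.

Lemma polygonP x s : is_path (polygon x s) x (last x s).
Proof.
elim: s x => [|y s IHs] x; first exact: is_path_cst.
exact: path_catP (geoP _ _ _) (IHs y).
Qed.

Lemma geo_strong e x y : eps_near e x y -> strong_partition e (geo x y) 0 1 [:: 1].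
Proof.
move=> xy; split; first exact: itv_partition1.
rewrite /= andbT; apply/asboolP => z [t /=]; rewrite in_itv /= => t01 <- {z}.
have [_ -> ->] := geoP geodesicX x y; rewrite !ballEmdist /=.
have := geo_dist geodesicX x y t01; rewrite (metric_sym y).
have := mdist_ge0 x (geo x y t); have := mdist_ge0 (geo x y t) y.
by move: xy; rewrite /eps_near; split; lra.
Qed.

(** The path ends with a constant piece, which is why the last point is
    repeated. *)
Lemma polygon_strong e x s : 0 < e -> eps_chain e (x :: s) ->
  strong_chain e (polygon x s) 0 1 (rcons (x :: s) (last x s)).
Proof.
move=> e0; rewrite eps_chain_cons; elim: s x => [|y s IHs] x /=.
  move=> _; exists [:: 1] => //; split; first exact: itv_partition1.
  rewrite /= andbT; apply/asboolP => z [t _ <-] {z}.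
  by rewrite !ballEmdist /= mdistxx.
move=> /andP[xy /IHs[w hw wE]].
have [_ g0 g1] := geoP geodesicX x y; have [_ p0 _] := polygonP y s.
have gp : geo x y 1 = polygon y s 0 by rewrite g1 p0.
have [v hv vE] := strong_partition_cat gp (geo_strong xy) hw.
exists v => //; rewrite vE -wE /chain_cat /= g0 g1.
by [].
Qed.

Lemma h_eps_polygon (x : X) (e : {posnum R}) s (hs : is_eps_loop e%:num x (x :: s))
    (f : loop R x) : f = polygon x s :> (R -> X) ->
  h_eps e (pi1_class f) = eps_class (EpsLoop hs).
Proof.
move=> fE; have e0 : 0 < e%:num by [].
have /and3P[cs _ /eqP /= ls] := hs.
have nxx : eps_near e%:num x x by rewrite /eps_near mdistxx.
have hs' : is_eps_loop e%:num x (rcons (x :: s) (last x s)).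
  rewrite /is_eps_loop last_rcons /= ls eqxx andbT /eps_chain /= rcons_path andbT ls nxx andbT.
  exact: cs.
have -> : h_eps e (pi1_class f) = eps_class (EpsLoop hs').
  by apply: h_eps_class; rewrite fE; exact: polygon_strong.
apply/eps_classP/eps_homotopic_sym/insertion_homotopic.
exists (x :: s), (last x s), [::]; split=> //=; rewrite ?cats0 ?cats1 //.
  by case/and3P: hs'.
by move=> w; rewrite last_rcons.
Qed.

Lemma h_eps_surj (x : X) (e : {posnum R}) (c : pi_eps e%:num x) :
  exists k, h_eps e k = c.
Proof.
have [b ->] := eps_class_surj c; case: b => -[//|y s] hs.
have /and3P[_ /eqP /= yx /eqP /= l] := hs; subst y.
have hp : is_path (polygon x s) x x by rewrite -[X in is_path _ _ X]l; exact: polygonP.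
by exists (pi1_class (Loop hp)); exact: h_eps_polygon.
Qed.

Definition in_ball z l f := forall t, 0 <= t <= 1 -> mdist z (f t) < l.

Lemma in_ball_cat z l f g : in_ball z l f -> in_ball z l g -> in_ball z l (path_cat f g).
Proof.
move=> hf hg t /andP[t0 t1]; rewrite /path_cat; case: ifP => h; first by apply: hf; lra.
by apply: hg; move/negbT: h; rewrite -ltNge; lra.
Qed.

Lemma in_ball_rev z l f : in_ball z l f -> in_ball z l (path_rev f).
Proof. by move=> hf t /andP[t0 t1]; apply: hf; lra. Qed.

Lemma in_ball_geo z l x y : mdist z x + mdist x y < l -> in_ball z l (geo x y).
Proof.
move=> h t /(geo_dist geodesicX x y).
have := metric_triangle z x (geo x y t); have := mdist_ge0 (geo x y t) y; lra.
Qed.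

Variable l : R.
(** This holds in a compact space with a simply connected cover, for l a
    Lebesgue number of the evenly covered sets. *)
Hypothesis small_null : forall z y f,
  is_path f y y -> in_ball z l f -> path_homotopic f (fun=> y).

Lemma small_homotopic z x y f g : is_path f x y -> is_path g x y ->
  in_ball z l f -> in_ball z l g -> path_homotopic f g.
Proof.
move=> pf pg bf bg; apply: (path_homotopic_cancel pf pg).
apply: (small_null (z := z)); first exact: path_catP pf (path_revP pg).
exact: in_ball_cat bf (in_ball_rev bg).
Qed.

Lemma geo_null x : path_homotopic (geo x x) (fun=> x).
Proof.
have pg := geoP geodesicX x x; apply: path_homotopic_eq; first by case: pg.
move=> t /(geo_dist geodesicX x x); rewrite mdistxx => h.
have h1 := mdist_ge0 x (geo x x t); have h2 := mdist_ge0 (geo x x t) x.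
by apply/esym/mdist_positivity; lra.
Qed.

(** A triangle with sides < e stays within 2e of any of its vertices, so its two
    ways round are homotopic.  The default value w only serves to give the
    empty chain a polygon. *)
Lemma polygon_homotopic e b c : 2 * e <= l -> eps_homotopic e b c ->
  forall w, path_homotopic (polygon (head w b) (behead b)) (polygon (head w c) (behead c)).
Proof.
move=> el; move: b c; apply: (eps_homotopic_ind (Q := fun b c => forall w,
  path_homotopic (polygon (head w b) (behead b)) (polygon (head w c) (behead c)))).
- by move=> b w; exact: path_homotopic_refl (polygonP _ _).
- by move=> b c h w; exact/path_homotopic_sym/h.
- by move=> a b c h h' w; exact: path_homotopic_trans (h w) (h' w).
- move=> x t _ _ _ /=; apply: path_homotopic_sym.
  apply: (path_homotopic_trans _ (path_homotopic_1cat (polygonP x t))).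
  exact: path_homotopic_catl (geoP _ _ _) (polygonP _ _) (geo_null x).
- move=> x y z t xy xz zy _ _ /=.
  have pxz := geoP geodesicX x z; have pzy := geoP geodesicX z y.
  apply: (path_homotopic_trans (g := path_cat (path_cat (geo x z) (geo z y)) (polygon y t))); last first.
    exact: path_homotopic_sym (path_homotopic_catA pxz pzy (polygonP y t)).
  apply: (path_homotopic_catl (geoP _ _ _) (polygonP _ _)).
  move: xy xz zy; rewrite /eps_near => xy xz zy; have d0 := mdist_ge0 x z.
  apply: (small_homotopic (z := x) (geoP _ _ _) (path_catP pxz pzy)).
    by apply: in_ball_geo; rewrite mdistxx; lra.
  by apply: in_ball_cat; apply: in_ball_geo; rewrite ?mdistxx; lra.
- move=> x y s t xy _ _ h w /=.
  exact: path_homotopic_catr (geoP _ _ _) (polygonP _ _) (h w).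
Qed.

Lemma in_ball_strong e f t u : 0 <= t -> t <= u -> u <= 1 -> strong_step e f t u ->
  in_ball (f t) e (subpath f t u).
Proof.
move=> t0 tu u1 /asboolP h r /andP[r0 r1].
have /h[+ _] : (f @` `[t, u]) (subpath f t u r).
  by exists (t + r * (u - t)) => //=; rewrite in_itv /=; nra.
by rewrite ballEmdist.
Qed.

(** Each piece of f and the geodesic that replaces it lie in the same ball of
    radius e around their common start, hence are homotopic. *)
Lemma polygon_partition e f (a : R) (s : seq R) : e <= l -> {within `[0, 1], continuous f} ->
  0 <= a -> path <%R a s -> last a s <= 1 -> path (strong_step e f) a s ->
  path_homotopic (polygon (f a) (map f s)) (subpath f a (last a s)).
Proof.
move=> el cf; elim: s a => [|y s IHs] a a0 /=.
  move=> _ a1 _; apply: path_homotopic_eq; first by case: (is_path_cst R (f a)).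
  by move=> t _; rewrite /subpath subrr mulr0 addr0.
move=> /andP[ay ys] l1 /andP[h hs].
have yl := Defs.lt_path_le_last ys.
have {}IHs := IHs y (le_trans a0 (ltW ay)) ys l1 hs.
have y1 := le_trans yl l1.
have pay := subpathP a0 (ltW ay) y1 cf.
have pyl := subpathP (le_trans a0 (ltW ay)) yl l1 cf.
apply: (path_homotopic_trans _ (path_homotopic_sym (subpath_cat a0 (ltW ay) yl l1 cf))).
have [_ _ g1] := geoP geodesicX (f a) (f y); have [_ p0 _] := polygonP (f y) (map f s).
apply: path_homotopic_cat => //; first by rewrite g1 p0.
have b := in_ball_strong a0 (ltW ay) y1 h.
apply: (small_homotopic (z := f a) (geoP _ _ _) pay).
  apply: in_ball_geo; rewrite mdistxx add0r; have := b 1; rewrite lexx ler01 => /(_ isT).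
  by case: pay => _ _ ->; move=> /lt_le_trans; apply.
by move=> t /b /lt_le_trans; apply.
Qed.

Lemma polygon_partition01 e f (s : seq R) : e <= l -> {within `[0, 1], continuous f} ->
  strong_partition e f 0 1 s -> path_homotopic (polygon (f 0) (map f s)) f.
Proof.
move=> el cf [[s1 /eqP s2] s3].
have h := polygon_partition el cf (lexx 0) s1 (eq_ind_r (fun r : R => r <= 1) (lexx 1) s2) s3.
apply: (path_homotopic_trans h); rewrite s2; apply: path_homotopic_sym.
by apply: path_homotopic_eq => // t _; rewrite /subpath subr0 add0r mulr1.
Qed.

Lemma h_eps_inj (x : X) (e : {posnum R}) (g : pi1 R x) :
  2 * e%:num <= l -> h_eps e g = 1%g -> g = 1%g.
Proof.
have [f ->] := pi1_surj g => el; have e0 : 0 < e%:num by [].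
have [s hs] := strong_partition_exists (@loop_cont _ _ _ f) e0.
rewrite (h_eps_class (f := f) (c := EpsLoop (strong_loop_proof hs))); last by exists s.
rewrite -eps_class1 => /eps_classP /= /(polygon_homotopic el)/(_ x) /= h.
have el' : e%:num <= l by lra.
rewrite -pi1_class1; apply/pi1_classP.
exact: path_homotopic_trans (path_homotopic_sym (polygon_partition01 el' (@loop_cont _ _ _ f) hs)) h.
Qed.

(** The polygon of c is null because c is d-null, and the e-class of c is the
    image under [h_eps] of the class of its polygon. *)
Lemma eps_null_small (x : X) (e d : {posnum R}) c : 2 * d%:num <= l ->
  is_eps_loop e%:num x c -> eps_null d%:num x c -> eps_null e%:num x c.
Proof.
move=> dl; case: c => // y s hs; have /and3P[_ /eqP /= yx /eqP /= ls] := hs; subst y.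
move=> /(polygon_homotopic dl)/(_ x) /= h.
have hp : is_path (polygon x s) x x by rewrite -[X in is_path _ _ X]ls; exact: polygonP.
have := h_eps_polygon (f := Loop hp) hs erefl.
rewrite (_ : pi1_class _ = 1%g) ?h_eps1; last by rewrite -pi1_class1; exact/pi1_classP.
by rewrite -eps_class1 => /esym/eps_classP.
Qed.

End GeodesicPolygons.

(** * Small loops in a space with a simply connected cover *)

Section SmallLoopsLift.
Variables (R : realType) (X : metricType R).

Lemma within_comp_in (S T U : topologicalType) (A : set S) (B : set T)
    (g : S -> T) (f : T -> U) : (forall u, A u -> B (g u)) ->
  {within A, continuous g} -> {within B, continuous f} ->
  {within A, continuous (f \o g)}.
Proof.
move=> AB /subspace_continuousP cg /subspace_continuousP cf.
apply/subspace_continuousP => u Au V nV.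
have := cg u Au _ (cf _ (AB _ Au) _ nV); rewrite /= !nbhs_simpl /within /=.
by apply: filterS => y BV Ay; apply: BV => //; exact: AB.
Qed.

Lemma lebesgue_number (E : topologicalType) (p : E -> X) :
  compact [set: X] -> covering_map p ->
  exists2 l : R, 0 < l & forall z, exists2 U, evenly_covered p U &
    forall w, mdist z w < l -> U w.
Proof.
move=> cX [_ _ cov].
have := cX; rewrite compact_near_coveringP => /(_ R (0^'+)
  (fun d z => exists2 U, evenly_covered p U & forall w, mdist z w < d -> U w) _) [].
  move=> z _; have [U [oU Uz eU]] := cov z.
  have /nbhs_ballP[r /= r0 hr] : nbhs z U by exact: open_nbhs_nbhs.
  have r20 : 0 < r / 2 by lra.
  exists (ball z (r / 2), [set d | 0 < d < r / 2]) => /=.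
    split; first exact: nbhsx_ballx.
    near=> d; apply/andP; split; near: d; first exact: nbhs_right_gt.
    exact: nbhs_right_lt.
  move=> [z' d] /= []; rewrite ballEmdist /= => zz' /andP[d0 dr].
  exists U => // w zw; apply: hr; rewrite ballEmdist /=.
  by have := metric_triangle z z' w; lra.
move=> d /= d0 h; exists (d / 2); first lra.
move=> z; apply: (h (d / 2)) => //=; last by rewrite divr_gt0.
by rewrite sub0r normrN gtr0_norm ?divr_gt0 // ltr_pdivrMr // ltr_pMr // ltr1n.
Unshelve. all: by end_near. Qed.

(** No path lifting is needed: the inverse of the covering map on one sheet over
    an evenly covered ball carries the whole loop. *)
Lemma covered_loops_null : compact [set: X] -> has_simply_connected_cover R X ->
  exists2 l : R, 0 < l & forall z y (f : R -> X),
    is_path f y y -> in_ball z l f -> path_homotopic f (fun=> y).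
Proof.
move=> cX [E [p [[_ cov] [_ sc]]]]; have [cp surj _] := cov.
have [l l0 hl] := lebesgue_number cX cov; exists l => // z y f [cf f0 f1] bf.
have [U [sheets [pU _ hs]] zU] := hl z.
have Uz : U z by apply: zU; rewrite mdistxx.
have [z' pz'] := surj z.
have : (p @^-1` U) z' by rewrite /= pz'.
rewrite pU => -[V sV Vz']; have [_ [[fun_p _ surj_p] _ [q cq qp]]] := hs V sV.
have fU t : 0 <= t <= 1 -> U (f t) by move=> /bf /zU.
have pq t : 0 <= t <= 1 -> p (q (f t)) = f t.
  by move=> /fU /surj_p[v Vv <-]; rewrite qp.
have i0 : 0 <= (0 : R) <= 1 by lra.
have i1 : 0 <= (1 : R) <= 1 by lra.
have cqf : {within `[0, 1], continuous (q \o f)}.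
  by apply: within_comp_in cf cq => t /=; rewrite in_itv; exact: fU.
have pqf : is_path (q \o f) (q y) (q y) by split; rewrite //= ?f0 ?f1.
have := sc (q y) (pi1_class (Loop pqf)); rewrite -pi1_class1 => /pi1_classP /=.
move=> /(path_homotopic_comp cp) h.
apply: (path_homotopic_trans (g := p \o (q \o f))).
  by apply: path_homotopic_eq => // t t01; rewrite /= pq.
apply: (path_homotopic_trans h); apply: path_homotopic_eq.
  by case: (is_path_cst R (p (q y))).
by move=> t _; rewrite /= -f0 pq.
Qed.

End SmallLoopsLift.

(** * The covering space of chains up to homotopy *)

Section EpsCover.
Variables (R : realType) (X : metricType R) (e : R) (x : X).

Definition is_based_chain (c : seq X) : bool := eps_chain e c && (head x c == x).

Record based_chain := BasedChain
  { based_chain_seq :> seq X; based_chainP : is_based_chain based_chain_seq }.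
HB.instance Definition _ := [isSub for based_chain_seq].
HB.instance Definition _ := [Choice of based_chain by <:].

Definition based_chain_rel (b c : based_chain) : bool := `[< eps_homotopic e b c >].

Local Lemma based_chain_refl : reflexive based_chain_rel.
Proof. by move=> c; apply/asboolP/eps_homotopic_refl. Qed.

Local Lemma based_chain_sym : symmetric based_chain_rel.
Proof.
by move=> b c; apply/idP/idP => /asboolP h; apply/asboolP/eps_homotopic_sym.
Qed.

Local Lemma based_chain_trans : transitive based_chain_rel.
Proof.
move=> b a c /asboolP ab /asboolP bc; apply/asboolP.
exact: eps_homotopic_trans ab bc.
Qed.

Definition based_chain_equiv :=
  EquivRel based_chain_rel based_chain_refl based_chain_sym based_chain_trans.

Definition eps_cover := {eq_quot based_chain_equiv}.
HB.instance Definition _ := Choice.on eps_cover.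
HB.instance Definition _ := Quotient.on eps_cover.

Implicit Types (a b : eps_cover) (c : seq X) (z w : X).

Local Fact base_chain_proof : is_based_chain [:: x].
Proof. by rewrite /is_based_chain /= eqxx. Qed.

Definition chain_class c : eps_cover :=
  \pi_eps_cover (insubd (BasedChain base_chain_proof) c).

Lemma chain_classP c c' : is_based_chain c -> is_based_chain c' ->
  chain_class c = chain_class c' <-> eps_homotopic e c c'.
Proof.
move=> hc hc'; split=> [/eqmodP /asboolP|h].
  by rewrite !val_insubd hc hc'.
by apply/eqmodP/asboolP; rewrite !val_insubd hc hc'.
Qed.

Lemma chain_class_repr a : chain_class (repr a) = a.
Proof. by rewrite /chain_class valKd reprK. Qed.

Lemma chain_class_surj a : exists2 c, is_based_chain c & a = chain_class c.
Proof. by exists (repr a); [exact: based_chainP|rewrite chain_class_repr]. Qed.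

Definition endpoint a : X := last x (repr a).

Lemma endpoint_class c : is_based_chain c -> endpoint (chain_class c) = last x c.
Proof.
move=> hc; have : chain_class (repr (chain_class c)) = chain_class c.
  exact: chain_class_repr.
by move=> /(chain_classP (based_chainP _) hc) /eps_homotopic_ends/(_ x)[].
Qed.

Lemma is_based_chain_rcons c z :
  is_based_chain c -> eps_near e (last x c) z -> is_based_chain (rcons c z).
Proof.
case: c => // y c /andP[]; rewrite /is_based_chain eps_chain_cons /= => h -> cz.
by rewrite eps_chain_cons rcons_path h cz.
Qed.

(** Adding a point to a chain is the local inverse of [endpoint] through a;
    the topology and all lifts are expressed with it. *)
Definition extend a z : eps_cover := chain_class (rcons (repr a) z).

Lemma extend_class c z : is_based_chain c -> eps_near e (last x c) z ->
  extend (chain_class c) z = chain_class (rcons c z).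
Proof.
move=> hc cz; set r := repr (chain_class c).
have rc : eps_homotopic e r c.
  by apply/(chain_classP (based_chainP _) hc); exact: chain_class_repr.
have [_ lr] := eps_homotopic_ends rc x.
have hr : is_based_chain r by exact: based_chainP.
have rz : eps_near e (last x r) z by rewrite lr.
apply/chain_classP; [exact: is_based_chain_rcons..|].
have zz : eps_chain e [:: last x r; z] by rewrite eps_chain_cons /= rz.
have := eps_homotopic_catr rc zz; rewrite /chain_cat /= !cats1; apply=> v.
by case: (val r) hr.
Qed.

Lemma endpoint_extend a z : eps_near e (endpoint a) z -> endpoint (extend a z) = z.
Proof.
move=> az; rewrite /extend endpoint_class ?last_rcons //.
exact: is_based_chain_rcons (based_chainP _) az.
Qed.

(** The three points endpoint a, z and w form a small triangle, so z can be
    dropped by a basic move. *)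
Lemma extend_extend a z w : eps_near e (endpoint a) z -> eps_near e z w ->
  eps_near e (endpoint a) w -> extend (extend a z) w = extend a w.
Proof.
move=> az zw aw; have hr := based_chainP (repr a).
have hz : is_based_chain (rcons (repr a) z) by exact: is_based_chain_rcons.
have hw : is_based_chain (rcons (repr a) w) by exact: is_based_chain_rcons.
have hzw : is_based_chain (rcons (rcons (repr a) z) w).
  by apply: is_based_chain_rcons; rewrite ?last_rcons.
rewrite [extend a z]/extend extend_class ?last_rcons //.
apply/chain_classP => //; apply: eps_homotopic_sym.
have := @insert_homotopic _ _ e (repr a) z [:: w]; rewrite -cat_rcons !cats1.
case/andP: hr => /andP[rn _] _; case/andP: hw => cw _; case/andP: hzw => czw _.
exact.
Qed.

(** The topology in which points close to a are the extensions of a by points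
    close to its end. *)
Definition eps_cover_open (U : set eps_cover) : Prop := forall a, U a ->
  exists2 r : R, 0 < r &
    forall z, eps_near r (endpoint a) z -> eps_near e (endpoint a) z -> U (extend a z).

Local Fact eps_cover_openT : eps_cover_open setT.
Proof. by move=> a _; exists 1. Qed.

Local Fact eps_cover_openI : setI_closed eps_cover_open.
Proof.
move=> U V oU oV a [/oU[r r0 hr] /oV[s s0 hs]].
exists (Num.min r s); first by rewrite lt_min r0.
by move=> z; rewrite /eps_near lt_min => /andP[zr zs] az; split; [exact: hr|exact: hs].
Qed.

Local Fact eps_cover_open_bigU (I : Type) (F : I -> set eps_cover) :
  (forall i, eps_cover_open (F i)) -> eps_cover_open (\bigcup_i F i).
Proof.
move=> oF a [i _ /oF[r r0 hr]]; exists r => // z zr az.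
by exists i => //; exact: hr.
Qed.

HB.instance Definition _ := isOpenTopological.Build eps_cover
  eps_cover_openT eps_cover_openI eps_cover_open_bigU.

Lemma eps_cover_openE (U : set eps_cover) : open U = eps_cover_open U.
Proof. by []. Qed.

Hypothesis e0 : 0 < e.

Lemma eps_near_refl z : eps_near e z z.
Proof. by rewrite /eps_near mdistxx. Qed.

Lemma extend_endpoint a : extend a (endpoint a) = a.
Proof.
rewrite -[in RHS](chain_class_repr a); have hr := based_chainP (repr a).
have nr := eps_near_refl (endpoint a).
apply/chain_classP => //; first exact: is_based_chain_rcons.
rewrite /endpoint; move: hr; rewrite /is_based_chain; case: (val (repr a)) => // y s /andP[ys _].
apply/eps_homotopic_sym/insertion_homotopic; exists (y :: s), (last y s), [::].
split=> //=; rewrite ?cats0 ?cats1 //; last by move=> w; rewrite last_rcons.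
by move: ys; rewrite !eps_chain_cons rcons_path => ->; exact: eps_near_refl.
Qed.

Lemma extend_back a z : eps_near e (endpoint a) z -> extend (extend a z) (endpoint a) = a.
Proof.
move=> az; rewrite extend_extend ?extend_endpoint //; first by rewrite eps_near_sym.
exact: eps_near_refl.
Qed.

Lemma extend_inj a b z : eps_near e (endpoint a) z -> endpoint a = endpoint b ->
  extend a z = extend b z -> a = b.
Proof. by move=> az ab /(congr1 (extend^~ (endpoint a))); rewrite extend_back // ab extend_back -?ab. Qed.


Lemma eps_near_ball_open z (r : R) : open [set w : X | eps_near r z w].
Proof.
rewrite openE => w /= zw; apply/nbhs_ballP; exists (r - mdist z w) => /=.
  by rewrite subr_gt0.
move=> u; rewrite ballEmdist /= => wu; rewrite /eps_near.
by have := metric_triangle z w u; lra.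
Qed.

Lemma eps_cover_ball_open a (r : R) : r <= e ->
  open [set b | eps_near r (endpoint a) (endpoint b) /\ b = extend a (endpoint b)].
Proof.
move=> re; rewrite eps_cover_openE => b /= [ab bE]; exists (r - mdist (endpoint a) (endpoint b)).
  by rewrite subr_gt0.
move=> z; rewrite /eps_near => h bz.
have tri := metric_triangle (endpoint a) (endpoint b) z.
have az : eps_near r (endpoint a) z by rewrite /eps_near; lra.
have are w : eps_near r (endpoint a) w -> eps_near e (endpoint a) w.
  by move=> /lt_le_trans; apply.
by rewrite /= endpoint_extend //; split=> //; rewrite {1}bE extend_extend //; exact: are.
Qed.

Lemma nbhs_eps_cover a (W : set eps_cover) : nbhs a W <-> exists2 r : R, 0 < r &
  forall z, eps_near r (endpoint a) z -> eps_near e (endpoint a) z -> W (extend a z).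
Proof.
split=> [|[r r0 hr]].
  rewrite nbhsE => -[U [+ Ua] UW]; rewrite eps_cover_openE => oU.
  by have [r r0 hr] := oU a Ua; exists r => // z zr ze; exact/UW/hr.
(* The radius is cut down to e because only extensions within e are
meaningful. *)
pose s := Num.min r e.
have se : s <= e by rewrite ge_min lexx orbT.
have s0 : 0 < s by rewrite lt_min r0.
rewrite nbhsE; exists [set b | eps_near s (endpoint a) (endpoint b) /\ b = extend a (endpoint b)].
  split; first exact: eps_cover_ball_open.
  by split; rewrite ?extend_endpoint // /eps_near mdistxx.
move=> b [+ ->]; rewrite /eps_near lt_min => /andP[h1 h2].
exact: hr.
Qed.

Lemma nbhs_extend a : nbhs a [set b | eps_near e (endpoint a) (endpoint b) /\ b = extend a (endpoint b)].
Proof.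
apply/nbhs_eps_cover; exists e => // z _ az.
by rewrite /= endpoint_extend.
Qed.

Lemma endpoint_continuous : continuous endpoint.
Proof.
move=> a W; rewrite /= nbhs_simpl => /nbhs_ballP[r /= r0 hr]; apply/nbhs_eps_cover; exists r => //.
by move=> z zr az; rewrite /= endpoint_extend //; apply: hr; rewrite ballEmdist.
Qed.

(** Convergence upstairs is convergence of the ends, provided that the nearby
    values are extensions of the limit. *)
Lemma cvg_eps_cover (S : Type) (F : set_system S) (f : S -> eps_cover) a : Filter F ->
  (endpoint \o f) u @[u --> F] --> endpoint a ->
  (\forall u \near F, f u = extend a (endpoint (f u))) -> f u @[u --> F] --> a.
Proof.
move=> FF pf hf W /nbhs_eps_cover[r r0 hr].
have := pf _ (nbhsx_ballx (endpoint a) _ r0); have := pf _ (nbhsx_ballx (endpoint a) _ e0).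
rewrite !ballEmdist /nbhs /= => h1 h2.
near=> u; rewrite /= (near hf u) //; apply: hr.
  by near: u; exact: h2.
by near: u; exact: h1.
Unshelve. all: by end_near. Qed.

Lemma extend_continuous a : {within [set w | eps_near e (endpoint a) w], continuous (extend a)}.
Proof.
apply/subspace_continuousP => w /= aw; apply: cvg_eps_cover.
  rewrite /= endpoint_extend // => W nW; rewrite /nbhs /= /within /=.
  by near=> u => au; rewrite /= endpoint_extend //; near: u.
rewrite /prop_near1 /nbhs /= /within /=.
near=> u => au; rewrite -[LHS]/(extend a u) -[RHS]/(extend (extend a w) (endpoint (extend a u))).
 rewrite endpoint_extend // extend_extend //.
near: u; have := nbhsx_ballx w e e0; apply: filterS => u.
by rewrite ballEmdist.
Unshelve. all: by end_near. Qed.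

(** Over the ball of radius e around z, the sheets are the sets of extensions of
    the classes of chains that end at z; extending back to z shows that
    they are disjoint and cover the preimage. *)
Lemma eps_cover_evenly_covered z : evenly_covered endpoint [set w | eps_near e z w].
Proof.
pose V a := [set b | eps_near e (endpoint a) (endpoint b) /\ b = extend a (endpoint b)].
exists [set V a | a in [set a | endpoint a = z]]; split.
- apply/seteqP; split=> b /=.
    move=> zb; have bz : eps_near e (endpoint b) z by rewrite eps_near_sym.
    exists (V (extend b z)); first by exists (extend b z) => //=; rewrite endpoint_extend.
    by rewrite /V /= endpoint_extend // extend_back.
  by move=> [_ [a /= az <-]] [/=]; rewrite az.
- move=> _ _ [a /= az <-] [b /= bz <-] [c [[h1 h2] [h3 h4]]].
  rewrite /= in h1 h2 h3 h4 *.
  by rewrite (extend_inj (a := a) (b := b) h1) // ?az ?bz // -h2 -h4.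
- move=> _ [a /= az <-]; split; first exact: eps_cover_ball_open.
  split; first split.
  + by move=> b /= [h _]; rewrite -az.
  + by move=> b c /set_mem [/= _ bE] /set_mem [/= _ cE] bc; rewrite bE cE bc.
  + move=> w /= zw; exists (extend a w); last by rewrite endpoint_extend // az.
    by rewrite /V /= endpoint_extend // az.
  + by apply: continuous_subspaceT => b; exact: endpoint_continuous.
  + exists (extend a); first by rewrite -az; exact: extend_continuous.
    by move=> b [_ /= <-].
Qed.

End EpsCover.

(** * Unique lifting of paths to the space of chains *)

Section SegmentArguments.
Variable R : realType.

(** Connectedness of a segment, for a property that is locally constant. *)
Lemma segment_induction (a b : R) (P : R -> Prop) : P a ->
  (forall t, a <= t <= b -> exists2 r, 0 < r &
     forall u, a <= u <= b -> `|t - u| < r -> P t <-> P u) ->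
  forall t, a <= t <= b -> P t.
Proof.
move=> Pa loc t tab.
have ab : a <= b by lra.
have opn (Q : R -> Prop) : (forall t, a <= t <= b -> Q t -> exists2 r, 0 < r &
     forall u, a <= u <= b -> `|t - u| < r -> Q u) ->
   exists2 C : set R, open C & forall u, a <= u <= b -> (C u <-> Q u).
  move=> h; exists (\bigcup_(D in [set D : set R | open D /\
    forall u, a <= u <= b -> D u -> Q u]) D).
    by apply: bigcup_open => D [].
  move=> u uab; split=> [[D [_ hD] /hD]|Qu]; first exact.
  have [r r0 hr] := h u uab Qu.
  exists (ball u r); last exact: ballxx.
  by split; [exact: ball_open|move=> v vab uv; exact: hr].
have [C oC hC] : exists2 C : set R, open C & forall u, a <= u <= b -> (C u <-> P u).
  apply: opn => u uab Pu; have [r r0 hr] := loc u uab; exists r => // v vab uv.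
  by apply/(hr v vab uv).
have [D oD hD] : exists2 D : set R, open D & forall u, a <= u <= b -> (D u <-> ~ P u).
  apply: opn => u uab Pu; have [r r0 hr] := loc u uab; exists r => // v vab uv.
  by move=> /(hr v vab uv).
have itv u : `[a, b]%classic u <-> a <= u <= b by rewrite /= in_itv.
suff /seteqP[_ /(_ t)] : [set u | a <= u <= b /\ P u] = `[a, b]%classic.
  by case=> //; exact/itv.
apply: (@segment_connected R a b).
- by exists a; split; rewrite ?lexx.
- exists C => //; apply/seteqP; split=> u.
    by move=> [uab Pu]; split; [exact/itv|exact/hC].
  by move=> [/itv uab /hC Pu]; split=> //; exact: Pu.
- exists (~` D); first exact: open_closedC.
  apply/seteqP; split=> u.
    by move=> [uab Pu]; split; [exact/itv|move=> /(hD _ uab)].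
  move=> [/itv uab Du]; split=> //; apply: contrapT => nP.
  by apply: Du; apply/hD.
Qed.

Lemma path_connected_connected (T : topologicalType) (x : T) :
  (forall y, exists f : R -> T, is_path f x y) -> connected [set: T].
Proof.
move=> pc.
have -> : [set: T] = \bigcup_(A in [set A : set T | A x /\ connected A]) A.
  apply/seteqP; split=> // y _; have [f [cf f0 f1]] := pc y.
  exists (f @` `[0, 1]); last by exists 1 => //=; rewrite in_itv /= lexx ler01.
  split; first by exists 0 => //=; rewrite in_itv /= lexx ler01.
  by apply: connected_continuous_connected cf; exact: segment_connected.
by apply: bigcup_connected; [exists x => A []|move=> A []].
Qed.

Lemma continuous_within_near (T : topologicalType) (f : R -> T) (t : R) (W : set T) :
  {within `[0, 1], continuous f} -> 0 <= t <= 1 -> nbhs (f t) W ->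
  exists2 r : R, 0 < r & forall u, 0 <= u <= 1 -> `|t - u| < r -> W (f u).
Proof.
move=> /subspace_continuousP cf t01 nW.
have t01' : `[0, 1]%classic t by rewrite /= in_itv.
have := cf t t01' W nW; rewrite /nbhs /= /within /= => /nbhs_ballP[r /= r0 hr].
by exists r => // u u01 tu; apply: hr => //=; rewrite in_itv.
Qed.

End SegmentArguments.

Section LiftsToEpsCover.
Variables (R : realType) (X : metricType R) (e : R) (x : X).
Hypotheses (e0 : 0 < e) (geodesicX : geodesic_space X).
Local Notation E := (eps_cover e x).
Local Notation base := (chain_class e x [:: x]).
Implicit Types (f g : R -> E) (a b : E) (z w : X).

Lemma extend_path a z : eps_near e (endpoint a) z ->
  exists f, is_path f a (extend a z).
Proof.
move=> az; have [cg g0 g1] := geoP geodesicX (endpoint a) z.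
exists (extend a \o geo geodesicX (endpoint a) z); split; last 2 first.
- by rewrite /= g0 extend_endpoint.
- by rewrite /= g1.
apply: within_comp_in cg (extend_continuous e0 (a := a)) => t /=; rewrite in_itv /=.
move=> /(geo_dist geodesicX (endpoint a) z); move: az; rewrite /eps_near.
by have := mdist_ge0 (geo geodesicX (endpoint a) z t) z; lra.
Qed.

Lemma path_from_base a : exists f, is_path f base a.
Proof.
have [c hc ->] := chain_class_surj a; elim/last_ind: c hc => [//|c z IHc].
case: c IHc => [_ /andP[_ /eqP /= ->]|y c IHc]; first by exists (fun=> base); exact: is_path_cst.
rewrite /is_based_chain rcons_cons eps_chain_cons rcons_path /= => /andP[/andP[yc cz] yx].
have hc : is_based_chain e x (y :: c) by rewrite /is_based_chain eps_chain_cons yc.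
have [f pf] := IHc hc.
have [|g pg] := @extend_path (chain_class e x (y :: c)) z; first by rewrite endpoint_class.
exists (path_cat f g); rewrite -rcons_cons -extend_class //.
exact: path_catP pf pg.
Qed.

Lemma endpoint_surj z : exists a : E, endpoint a = z.
Proof.
have [cg g0 g1] := geoP geodesicX x z.
have [s hs] := strong_partition_exists cg e0.
have hc : is_based_chain e x (map (geo geodesicX x z) (0 :: s)).
  by rewrite /is_based_chain (strong_partition_chain hs) /= g0.
exists (chain_class e x (map (geo geodesicX x z) (0 :: s))).
by rewrite endpoint_class //= last_map; case: hs => -[_ /eqP ->].
Qed.

Lemma eps_cover_is_cover : is_cover (@endpoint R X e x).
Proof.
split; first exact: path_connected_connected path_from_base.
split; [exact: endpoint_continuous|exact: endpoint_surj|move=> z].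
exists [set w | eps_near e z w]; split.
- exact: eps_near_ball_open.
- exact: eps_near_refl.
- exact: eps_cover_evenly_covered.
Qed.

Lemma path_local_extend f t : {within `[0, 1], continuous f} -> 0 <= t <= 1 ->
  exists2 r : R, 0 < r & forall u, 0 <= u <= 1 -> `|t - u| < r ->
    eps_near e (endpoint (f t)) (endpoint (f u)) /\ f u = extend (f t) (endpoint (f u)).
Proof. by move=> cf t01; exact: continuous_within_near cf t01 (nbhs_extend e0 (f t)). Qed.

(** Near t both lifts extend their value at t by the same points, so agreement is
    locally constant. *)
Lemma unique_lift f g : {within `[0, 1], continuous f} ->
  {within `[0, 1], continuous g} -> f 0 = g 0 ->
  (forall t, 0 <= t <= 1 -> endpoint (f t) = endpoint (g t)) ->
  forall t, 0 <= t <= 1 -> f t = g t.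
Proof.
move=> cf cg fg0 pfg; apply: segment_induction => // t t01.
have [r r0 hr] := path_local_extend cf t01; have [s s0 hs] := path_local_extend cg t01.
exists (Num.min r s); first by rewrite lt_min r0.
move=> u u01; rewrite lt_min => /andP[/(hr u u01)[nf fE] /(hs u u01)[ng gE]].
split=> [E|E]; first by rewrite fE gE -(pfg u u01) E.
by rewrite -(extend_back e0 nf) -(extend_back e0 ng) -fE -gE E pfg.
Qed.

(** The path and the extensions of f t by the points below the path are two lifts
    of the same path as long as these points stay within e of the start,
    which is what a strong step says. *)
Lemma strong_step_extend f t u : {within `[0, 1], continuous f} ->
  0 <= t -> t <= u -> u <= 1 -> strong_step e (@endpoint R X e x \o f) t u ->
  f u = extend (f t) (endpoint (f u)).
Proof.
move=> cf t0 tu u1 /asboolP st.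
have near_t v : t <= v <= u -> eps_near e (endpoint (f t)) (endpoint (f v)).
  move=> tvu; have /st[+ _] : ((@endpoint R X e x \o f) @` `[t, u]) (endpoint (f v)).
    by exists v => //=; rewrite in_itv.
  by rewrite ballEmdist.
apply: (@segment_induction R t u (fun v => f v = extend (f t) (endpoint (f v)))); last by lra.
  by rewrite extend_endpoint.
move=> v tvu; have v01 : 0 <= v <= 1 by lra.
have [r r0 hr] := path_local_extend cf v01; exists r => // w twu vw.
have w01 : 0 <= w <= 1 by lra.
have [nvw wE] := hr w w01 vw.
have nv := near_t v tvu; have nw := near_t w twu.
split=> E; first by rewrite {1}wE {1}E extend_extend.
rewrite -{1}(extend_back e0 nvw) -wE {1}E extend_extend //.
by rewrite eps_near_sym.
Qed.

Lemma foldl_extend c s : is_based_chain e x c -> path (eps_near e) (last x c) s ->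
  foldl (@extend R X e x) (chain_class e x c) s = chain_class e x (c ++ s).
Proof.
elim: s c => [|z s IHs] c hc /=; first by rewrite cats0.
move=> /andP[cz zs]; rewrite extend_class // -cat_rcons IHs ?last_rcons //.
exact: is_based_chain_rcons.
Qed.

Lemma lift_strong_partition f (t : R) (s : seq R) : {within `[0, 1], continuous f} ->
  0 <= t -> path <%R t s -> last t s <= 1 ->
  path (strong_step e (@endpoint R X e x \o f)) t s ->
  f (last t s) = foldl (@extend R X e x) (f t) (map (@endpoint R X e x \o f) s).
Proof.
move=> cf; elim: s t => //= u s IHs t t0 /andP[tu us] l1 /andP[h hs].
have ul := Defs.lt_path_le_last us.
have u0 : 0 <= u by lra.
by rewrite (IHs u) // -(strong_step_extend cf t0 (ltW tu) (le_trans ul l1) h).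
Qed.

(** The end of the lift is the class of the strong chain itself; for a loop it is
    also the class of the trivial chain. *)
Lemma lifted_loop_null f s : is_path f base base ->
  strong_partition e (@endpoint R X e x \o f) 0 1 s ->
  eps_null e x (map (@endpoint R X e x \o f) (0 :: s)).
Proof.
move=> [cf f0 f1] hs; have := strong_partition_chain hs; case: hs => -[s1 /eqP s2] s3.
have bx : is_based_chain e x [:: x] by rewrite /is_based_chain /= eqxx.
have px : endpoint base = x by rewrite endpoint_class.
have l1 : last 0 s <= 1 by rewrite s2.
have := lift_strong_partition cf (lexx 0) s1 l1 s3; rewrite s2 f1 f0.
rewrite /= f0 px eps_chain_cons => E hc.
move: E; rewrite foldl_extend //= => /esym/chain_classP; apply=> //.
by rewrite /is_based_chain eps_chain_cons hc /=.
Qed.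

End LiftsToEpsCover.

(** * Lifting of squares and simple connectivity *)

Section SquareLifting.
Variables (R : realType) (X : metricType R) (e : R) (x : X).
Hypotheses (e0 : 0 < e).
Local Notation E := (eps_cover e x).
Local Notation base := (chain_class e x [:: x]).
Local Notation square := (`[0, 1] `*` `[0, 1])%classic.

Lemma constant_chain_class (T : Type) (s : seq T) :
  chain_class e x (x :: map (fun=> x) s) = base.
Proof.
have nx := eps_near_refl e0 x.
have cs (u : seq T) : eps_chain e (x :: map (fun=> x) u).
  by rewrite eps_chain_cons; elim: u => //= _ u ->; rewrite nx.
apply/chain_classP; rewrite /is_based_chain ?cs //= ?eqxx //.
elim: s => [|i s IHs] /=; first exact: eps_homotopic_refl.
apply: eps_homotopic_trans IHs; apply: eps_homotopic_sym.
exact: eps_homotopic_dup.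
Qed.

(** The lift at u is the class of the chain of values of H at the n + 1 equally
    spaced points of the segment from the origin to u, where n is given by
    uniform continuity.  Moving u slightly gives a ladder between two such
    chains, whence continuity.  The last clause serves to recognize the lift
    on a side through the origin along which H is constant. *)
Lemma square_lift (H : R * R -> X) :
  {within square, continuous H} -> H (0, 0) = x ->
  exists K : R * R -> E, [/\ {within square, continuous K},
    forall u, square u -> endpoint (K u) = H u
    & forall u, (forall r, 0 <= r <= 1 -> H (r * u.1, r * u.2) = x) -> K u = base].
Proof.
move=> cH H00.
have [d d0 hd] := Defs.unif_cont (compact_setX (@segment_compact R 0 1) (@segment_compact R 0 1)) cH e0.
have [n n0 nd] : exists2 n : nat, (0 < n)%N & n%:R^-1 < d / 2.
  exists (Num.truncn (d / 2)^-1).+1 => //.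
  by rewrite -[X in _ < X]invrK ltf_pV2 ?posrE ?invr_gt0 ?divr_gt0 ?truncnS_gt.
have nR : 0 < n%:R :> R by rewrite ltr0n.
pose q (i : nat) (u : R * R) : R * R := (i%:R / n%:R * u.1, i%:R / n%:R * u.2).
have q_bound i : (i <= n)%N -> 0 <= (i%:R / n%:R : R) <= 1.
  by move=> ile; rewrite divr_ge0 ?ler0n //= ler_pdivrMr // mul1r ler_nat.
have qsq i u : (i <= n)%N -> square u -> square (q i u).
  move=> /q_bound /andP[i0 i1] /= []; rewrite !in_itv /= => /andP[a0 a1] /andP[b0 b1].
  by nra.
have close (i j : nat) (u v : R * R) : (i <= n)%N -> (j <= n)%N -> square u -> square v ->
    (j = i \/ j = i.+1) -> `|u.1 - v.1| < d / 2 -> `|u.2 - v.2| < d / 2 ->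
    eps_near e (H (q i u)) (H (q j v)).
  move=> ile jle su sv ij uv1 uv2; apply: hd; [exact: qsq|exact: qsq|].
  have qi := q_bound i ile; have qj := q_bound j jle.
  have step : `|i%:R / n%:R - j%:R / n%:R| < d / 2 :> R.
    case: ij => ->; first by rewrite subrr normr0 divr_gt0.
    by rewrite -natr1 mulrDl mul1r opprD addrA subrr sub0r normrN gtr0_norm ?invr_gt0.
  have main (a b y z : R) : 0 <= a <= 1 -> 0 <= z <= 1 -> `|a - b| < d / 2 ->
      `|y - z| < d / 2 -> `|a * y - b * z| < d.
    move=> /andP[a0 a1] /andP[z0 z1] ab yz.
    have -> : a * y - b * z = a * (y - z) + (a - b) * z by ring.
    apply: le_lt_trans (ler_normD _ _) _; rewrite !normrM (ger0_norm a0) (ger0_norm z0).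
    by have := normr_ge0 (a - b); have := normr_ge0 (y - z); nra.
  case: sv => /=; rewrite !in_itv /= => v1 v2.
  by split; apply: main.
pose c u := [seq H (q i u) | i <- iota 0 n.+1].
pose K u := chain_class e x (c u).
have q0 u : q 0%N u = (0, 0) by rewrite /q mul0r !mul0r.
have qn u : q n u = u by rewrite /q divff ?lt0r_neq0 // !mul1r; case: u.
have lastc u v : last v (c u) = H u.
  by rewrite /c -[n.+1]addn1 iotaD map_cat last_cat /= add0n qn.
have iota_path (P : rel nat) : (forall i, (i < n)%N -> P i i.+1) -> path P 0%N (iota 1 n).
  move=> hP; have : forall m k, (m + k = n)%N -> path P m (iota m.+1 k).
    move=> m k; elim: k m => //= k IHk m mk; rewrite hP ?IHk //; lia.
  by apply.
have half : 0 < d / 2 by lra.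
have zz (a : R) : `|a - a| < d / 2 by rewrite subrr normr0.
have cP u : square u -> is_based_chain e x (c u).
  move=> su; rewrite /is_based_chain /c /= eps_chain_cons path_map q0 H00 eqxx andbT.
  apply: (iota_path (fun i j => eps_near e (H (q i u)) (H (q j u)))).
  by move=> i ilt; apply: close => //; [exact: ltnW|right].
have stepK u v : square u -> square v -> `|u.1 - v.1| < d / 2 -> `|u.2 - v.2| < d / 2 ->
    K v = extend (K u) (H v).
  move=> su sv uv1 uv2; have lastn : last 0%N (iota 1 n) = n.
    by have := last_map (fun i : nat => i) (iota 1 n) 0%N; case: (n) n0 => // m _;
       rewrite -[m.+1]addn1 iotaD last_cat /= add1n addn1.
  have nuv : eps_near e (H u) (H v).
    by have := close n n u v (leqnn _) (leqnn _) su sv (or_introl erefl) uv1 uv2; rewrite !qn.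
  have cuv : is_based_chain e x (rcons (c u) (H v)).
    by apply: is_based_chain_rcons; rewrite ?lastc //; exact: cP.
  rewrite extend_class ?lastc //; last exact: cP.
  apply/chain_classP => //; first exact: cP.
  have := @eps_homotopic_ladder R X nat e (fun i => H (q i u)) (fun i => H (q i v)) 0%N (iota 1 n).
  rewrite lastn qn /= !q0 H00 => lad; apply: eps_homotopic_sym.
  rewrite /c /= !q0 H00; apply: (eps_homotopic_trans (lad _ _)).
  - apply: iota_path => i ilt; apply/and3P; split; apply: close => //; try exact: ltnW; try by right.
  - rewrite (eps_near_refl e0) /=; apply/allP => i; rewrite mem_iota => /andP[_ ilt].
    have ile : (i <= n)%N by lia.
    by apply: close => //; left.
  - apply: eps_homotopic_sym; apply: eps_homotopic_dup; first exact: eps_near_refl.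
    by have := cP v sv; rewrite /is_based_chain /c /= q0 H00 => /andP[].
exists K; split.
- apply/subspace_continuousP => u su; apply: cvg_eps_cover => //.
    move=> W; rewrite /K endpoint_class ?lastc; last exact: cP.
    move/subspace_continuousP: cH => /(_ u su) /[apply].
    rewrite /nbhs /= /within /=; apply: filterS => v hv sv.
    by rewrite /= endpoint_class ?lastc; [exact: hv|exact: cP].
  rewrite /prop_near1 /nbhs /= /within /=.
  have := nbhsx_ballx u _ half; apply: filterS => v [/= uv1 uv2] sv.
  have -> : endpoint (K v) = H v by rewrite /K endpoint_class ?lastc //; exact: cP.
  exact: stepK.
- by move=> u su; rewrite /K endpoint_class ?lastc //; exact: cP.
- move=> u hu; rewrite /K /c /= q0 H00.
  rewrite (_ : [seq _ | i <- _] = map (fun=> x) (iota 1 n)) ?constant_chain_class //.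
  apply/eq_in_map => i; rewrite mem_iota => /andP[_ ilt]; apply: hu.
  by apply: q_bound; lia.
Qed.

End SquareLifting.

Section SimpleConnectivity.
Variables (R : realType) (X : metricType R) (e : {posnum R}) (x : X).
Hypotheses (geodesicX : geodesic_space X).
Hypothesis h_inj : forall g : pi1 R x, h_eps e g = 1%g -> g = 1%g.
Local Notation E := (eps_cover e%:num x).
Local Notation base := (chain_class e%:num x [:: x]).

Let e0 : 0 < e%:num. Proof. by []. Qed.

(** The null-homotopy of the image of f in X lifts to a square K.  Its side over
    the image of f is f, and its three other sides lie over constant paths;
    both facts are instances of [unique_lift]. *)
Lemma base_loops_null (f : R -> E) : is_path f base base -> path_homotopic f (fun=> base).
Proof.
move=> pf; have [cf f0 f1] := pf.
have bx : is_based_chain e%:num x [:: x] by rewrite /is_based_chain /= eqxx.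
have px : endpoint base = x by rewrite endpoint_class.
have pp : is_path (@endpoint R X e%:num x \o f) x x.
  split; rewrite /= ?f0 ?f1 //.
  by move=> u; apply: cvg_comp; [exact: cf|exact: endpoint_continuous].
have [cp _ _] := pp.
have [s hs] := strong_partition_exists cp e0.
have null : path_homotopic (@endpoint R X e%:num x \o f) (fun=> x).
  have : pi1_class (Loop pp) = 1%g.
    apply: h_inj; rewrite (h_eps_class (f := Loop pp) (c := EpsLoop (strong_loop_proof (f := Loop pp) hs))).
      rewrite -eps_class1; apply/eps_classP.
      exact: (lifted_loop_null e0 pf hs).
    by exists s.
  by rewrite -pi1_class1 => /pi1_classP.
have [H [cH H0 H1]] := null.
have in1 t : 0 <= t <= 1 -> t \in `[0 : R, 1] by rewrite in_itv.
have sq s' t : 0 <= s' <= 1 -> 0 <= t <= 1 -> (`[0, 1] `*` `[0, 1])%classic (s', t : R).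
  by move=> h1 h2; split; rewrite /= in_itv.
have i0 : 0 <= (0 : R) <= 1 by lra.
have i1 : 0 <= (1 : R) <= 1 by lra.
have H00 : H (0, 0) = x by have [-> _] := H0 0 (in1 _ i0); rewrite /= f0.
have [K [cK pK Kx]] := square_lift e0 cH H00.
have cE (p : R -> R * R) : (forall t, 0 <= t <= 1 -> (`[0, 1] `*` `[0, 1])%classic (p t)) ->
    continuous p -> {within `[0, 1], continuous (K \o p)}.
  by move=> hp cp'; apply: within_comp2.
have cst_cont : {within `[0, 1], continuous (fun _ : R => base)}.
  by case: (is_path_cst R base).
have id_cont : continuous (fun t : R => t) by move=> t; exact: cvg_id.
have cst_R (r : R) : continuous (fun _ : R => r) by move=> t; exact: cvg_cst.
(* The side at t = 0 passes through the origin of the square. *)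
have Ks0 s' : 0 <= s' <= 1 -> K (s', 0) = base.
  move=> hs'; apply: Kx => r hr /=; rewrite mulr0.
  have rs01 : 0 <= r * s' <= 1 by move: hs' hr => /andP[? ?] /andP[? ?]; nra.
  by have [-> _] := H1 _ (in1 _ rs01); rewrite /= f0.
have K0t t : 0 <= t <= 1 -> K (0, t) = f t.
  apply: (@unique_lift _ _ _ _ e0 (K \o (fun t => (0, t)))) => //.
  - by apply: cE; [move=> u; exact: sq|exact: continuous_pair].
  - by rewrite /= Ks0.
  - move=> u hu; rewrite /= pK; last exact: sq.
    by have [-> _] := H0 u (in1 _ hu).
have K1t t : 0 <= t <= 1 -> K (1, t) = base.
  apply: (@unique_lift _ _ _ _ e0 (K \o (fun t => (1, t))) (fun=> base)) => //.
  - by apply: cE; [move=> u; exact: sq|exact: continuous_pair].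
  - by rewrite /= Ks0.
  - move=> u hu; rewrite /= pK; last exact: sq.
    by have [_ ->] := H0 u (in1 _ hu).
have Ks1 s' : 0 <= s' <= 1 -> K (s', 1) = base.
  apply: (@unique_lift _ _ _ _ e0 (K \o (fun t => (t, 1))) (fun=> base)) => //.
  - by apply: cE; [move=> u hu; exact: sq|exact: continuous_pair].
  - by rewrite /= K0t.
  - move=> u hu; rewrite /= pK; last exact: sq.
    by have [_ ->] := H1 u (in1 _ hu); rewrite /= f1.
exists K; split=> //.
- by move=> t; rewrite in_itv /= => ht; rewrite K0t ?K1t.
- by move=> t; rewrite in_itv /= => ht; rewrite Ks0 ?Ks1 // f0 f1.
Qed.

Lemma eps_cover_simply_connected : simply_connected R E.
Proof.
split=> [a b|a g].
  have [f pf] := path_from_base e0 geodesicX a; have [k pk] := path_from_base e0 geodesicX b.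
  by exists (path_cat (path_rev f) k); exact: path_catP (path_revP pf) pk.
have [f ->] := pi1_surj g; rewrite -pi1_class1; apply/pi1_classP => /=.
have [k pk] := path_from_base e0 geodesicX a.
have pf : is_path f a a by exact: loopP.
apply: (loop_homotopic_conj pk pf); apply: base_loops_null.
exact: path_catP (path_catP pk pf) (path_revP pk).
Qed.

Lemma h_inj_has_cover : has_simply_connected_cover R X.
Proof.
exists E, (@endpoint R X e%:num x); split; last exact: eps_cover_simply_connected.
exact: eps_cover_is_cover e0 geodesicX.
Qed.

End SimpleConnectivity.

(** * The maps from the fundamental group to the groups of chains *)

Section GroupIsomorphisms.
Implicit Types G H : groupType.

Lemma isomorphic_groups_inj_surj (G H : groupType) (f : G -> H) :
  {morph f : u v / (u * v)%g} -> (forall u, f u = 1%g -> u = 1%g) ->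
  (forall v, exists u, f u = v) -> isomorphic_groups G H.
Proof.
move=> fM ker surj; have f1 : f 1%g = 1%g by apply: (mulgI (f 1%g)); rewrite -fM !mulg1.
have fI : injective f.
  move=> u v uv; apply: (mulgI u^-1%g); rewrite mulVg; apply/esym/ker.
  by rewrite fM -uv -fM mulVg.
exists f => //; exists (fun v => projT1 (cid (surj v))) => [u|v]; case: cid => //= w.
exact: fI.
Qed.

Lemma isomorphic_groups_sym G H : isomorphic_groups G H -> isomorphic_groups H G.
Proof.
move=> [f [g fK gK] fM]; exists g; first by exists f.
by move=> u v; apply: (can_inj fK); rewrite fM !gK.
Qed.

Lemma isomorphic_groups_trans G H K :
  isomorphic_groups G H -> isomorphic_groups H K -> isomorphic_groups G K.
Proof.
move=> [f bf fM] [g bg gM]; exists (g \o f); first exact: bij_comp.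
by move=> u v; rewrite /= fM gM.
Qed.

End GroupIsomorphisms.

Section Projections.
Variables (R : realType) (X : metricType R) (x : X).
Implicit Types (d e : {posnum R}) (g : pi1 R x).

Lemma Phi_h_eps d e (de : d%:num < e%:num) g : Phi de (h_eps d g) = h_eps e g.
Proof.
have [f ->] := pi1_surj g; have d0 : 0 < d%:num by [].
have [s hs] := strong_partition_exists (@loop_cont _ _ _ f) d0.
have hs' : strong_partition e%:num f 0 1 s.
  case: hs => s1 s2; split=> //; apply: sub_path s2 => t u /asboolP h.
  apply/asboolP => y /h[]; rewrite !ballEmdist /= => h1 h2.
  by split; [exact: lt_trans h1 de|exact: lt_trans h2 de].
rewrite (h_eps_class (f := f) (c := EpsLoop (strong_loop_proof hs))); last by exists s.
rewrite (h_eps_class (f := f) (c := EpsLoop (strong_loop_proof hs'))); last by exists s.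
by rewrite Phi_class; congr eps_class; exact: val_inj.
Qed.

(** The d-chain of a class killed at the scale e is e-null, hence d-null. *)
Lemma h_eps_ker_no_critical d e g : d%:num < e%:num ->
  (forall r, r <= e%:num -> ~ Cr x r) -> h_eps e g = 1%g -> h_eps d g = 1%g.
Proof.
move=> de noCr; rewrite -(Phi_h_eps de); have [c ->] := eps_class_surj (h_eps d g).
rewrite Phi_class -!eps_class1 => /eps_classP /= ec; apply/eps_classP.
apply: (eps_null_no_critical (e := e%:num)) => //; first exact: ltW.
  by move=> r _; exact: noCr.
exact: eps_loopP.
Qed.

Lemma pi_cl_no_critical e g :
  (forall r, r <= e%:num -> ~ Cr x r) -> h_eps e g = 1%g -> pi_cl x g.
Proof.
move=> noCr eg d _; rewrite /K_eps /=.
have [de|ed|de] := ltgtP d%:num e%:num.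
- exact: h_eps_ker_no_critical de noCr eg.
- by rewrite -(Phi_h_eps ed) eg Phi1.
- by have -> : d = e by exact: val_inj.
Qed.

(** Since [h_eps] is bijective at and below e, an element of the inverse limit is
    determined by its component at e, and this component can be prescribed. *)
Lemma Delta_isomorphic e : geodesic_space X ->
  (forall d g, d%:num <= e%:num -> h_eps d g = 1%g -> g = 1%g) ->
  isomorphic_groups (pi1 R x) (Delta x).
Proof.
move=> geodesicX ker.
have comp g : compatible (fun e => h_eps e g) by move=> d d' dd'; exact: Phi_h_eps.
apply: (isomorphic_groups_inj_surj (f := fun g => MkDelta (comp g))).
- by move=> g h; apply: Delta_ext => d /=; rewrite h_epsM.
- by move=> g /(congr1 (fun u : Delta x => u e)) /=; exact: ker.
move=> u; have [g gu] := h_eps_surj geodesicX (u e).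
exists g; apply: Delta_ext => d /=.
have [de|ed|de] := ltgtP d%:num e%:num; last 2 first.
- by rewrite -(DeltaP u ed) -gu Phi_h_eps.
- by have -> : d = e by exact: val_inj.
have [h hu] := h_eps_surj geodesicX (u d).
suff -> : g = h by [].
have := DeltaP u de; rewrite -hu -gu Phi_h_eps => hg.
apply: (mulgI h^-1%g); rewrite mulVg.
by apply: (ker e) => //; rewrite h_epsM -hg -h_epsM mulVg h_eps1.
Qed.

Lemma pi1_bar_isomorphic : pi_cl x = [set 1%g] -> isomorphic_groups (pi1 R x) (pi1_bar x).
Proof.
move=> cl1; apply: (isomorphic_groups_inj_surj (f := @quotient_pi _ _ (pi_cl_normal x))).
- by move=> g h; exact: quotient_piM.
- move=> g /esym/quotient_piP; rewrite cl1 /= invg1 mul1g; exact.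
- by move=> a; exists (repr a); rewrite /quotient_pi reprK.
Qed.

End Projections.

Lemma positive_lower_bound (R : realType) (A : set R) : finite_set A ->
  (forall r, A r -> 0 < r) -> exists e : {posnum R}, forall r, A r -> e%:num < r.
Proof.
move=> /finite_seqP[s ->] /=; elim: s => [_|r s IHs h]; first by exists 1%:pos.
have [|e he] := IHs; first by move=> u us; apply: h; rewrite /= inE us orbT.
have r0 : 0 < r by apply: h; rewrite /= mem_head.
have m0 : 0 < Num.min e%:num (r / 2) by rewrite lt_min divr_gt0 // andbT.
exists (PosNum m0) => u /=; rewrite inE => /predU1P[->|/he eu].
  by rewrite gt_min; apply/orP; right; lra.
by rewrite gt_min eu.
Qed.

Theorem proposition4p10 (R : realType) (X : metricType R) (x : X)
    (compactX : compact [set: X]%classic) (geodesicX : geodesic_space X) :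
  (has_simply_connected_cover R X <->
     finite_set (Cr x) /\ pi_cl x = [set 1%g]%classic)
  /\
  (has_simply_connected_cover R X ->
     [/\ isomorphic_groups (pi1 R x) (pi1_bar x),
         isomorphic_groups (pi1_bar x) (Delta x)
       & isomorphic_groups (pi1 R x) (Delta x)]).
Proof.
have cover_ker : has_simply_connected_cover R X -> exists e : {posnum R},
    (forall (d : {posnum R}) (g : pi1 R x), d%:num <= e%:num -> h_eps d g = 1%g -> g = 1%g) /\
    (forall r, Cr x r -> e%:num <= r).
  move=> /(covered_loops_null compactX)[l l0 small].
  have l20 : 0 < l / 2 by lra.
  exists (PosNum l20); split=> [d g /= dl|r Cr_r /=].
    by apply: (h_eps_inj geodesicX small); lra.
  rewrite leNgt; apply/negP => rl; case: Cr_r => r0 [c [lc nc hc]]; apply: nc.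
  apply: (eps_null_small geodesicX small (e := PosNum r0) (d := PosNum l20)) => //=; first lra.
  exact: hc.
have forward : has_simply_connected_cover R X ->
    finite_set (Cr x) /\ pi_cl x = [set 1%g]%classic.
  move=> /cover_ker[e [ker low]]; split; first exact: (Cr_finite_above compactX geodesicX (e0 := e%:num)).
  apply/seteqP; split=> g /=; first by move=> /(_ e I); exact: ker.
  by move=> -> d _; exact: h_eps1.
split; first split=> //.
- move=> [fin cl1]; have [|e he] := positive_lower_bound fin; first by move=> r [].
  apply: (h_inj_has_cover (e := e) (x := x) geodesicX) => g eg.
  have : pi_cl x g.
    by apply: pi_cl_no_critical eg => r re /he; rewrite ltNge re.
  by rewrite cl1.
- move=> cover; have [e [ker _]] := cover_ker cover; have [_ cl1] := forward cover.
  have bar := pi1_bar_isomorphic cl1; have delta := Delta_isomorphic geodesicX ker.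
  by split=> //; exact: isomorphic_groups_trans (isomorphic_groups_sym bar) delta.
Qed.
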